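(* Let $V:[0,1]\to[0,1]$ be the middle-third Cantor (devil's staircase) function, let $B$ be standard Brownian motion, and let $X_t=B_{V(t)}$, $t\in[0,1]$. Then, almost surely, the graph $\mathcal{G}(X,[0,1])$ has Hausdorff dimension $1+\frac{\log 2}{2\log 3}$, and moreover $$\dim_F\mathcal{G}(X,[0,1])=0.$$
   Context: $\mathcal{G}(X,E)=\{(t,X_t):t\in E\}\subset\mathbb{R}^2$. Fourier dimension: for a Borel set $E\subset\mathbb{R}^2$, $\dim_F E$ is the supremum of all $\alpha\ge0$ for which there is a nonzero finite Borel measure $\mu$ supported on $E$ and a constant $C$ with $|\widehat\mu(\xi)|\le C|\xi|^{-\alpha/2}$ for all $\xi\ne0$, where $\widehat\mu(\xi)=\int e^{-2\pi i\xi\cdot x}\,d\mu(x)$. *)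

(* Defs.v *)
From HB Require Import structures.
From mathcomp Require Import all_boot all_order all_algebra.
From mathcomp Require Import complex.
From mathcomp Require Import all_classical all_reals all_analysis.

Set Implicit Arguments.
Unset Strict Implicit.
Unset Printing Implicit Defensive.

Import Order.TTheory GRing.Theory Num.Theory.
Import numFieldNormedType.Exports.

Local Open Scope classical_set_scope.
Local Open Scope ring_scope.
Local Open Scope complex_scope.

(* Iterative construction: the maps [cantor_iter n] converge uniformly on
   [0, 1] to the unique bounded V with V(x) = V(3x)/2 on [0, 1/3], V = 1/2 on
   ]1/3, 2/3[ and V(x) = (1 + V(3x - 2))/2 on [2/3, 1].  Only arguments in
   [0, 1] are meaningful. *)
Fixpoint cantor_iter {R : realType} (n : nat) (x : R) : R :=
  if n is m.+1 then
    if x <= 1 / 3 then cantor_iter m (3 * x) / 2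
    else if x < 2 / 3 then 1 / 2
    else 1 / 2 + cantor_iter m (3 * x - 2) / 2
  else x.

Definition cantor_function {R : realType} (x : R) : R :=
  limn (fun n => cantor_iter n x).

(* The product rule for subfamilies is the case [A i = setT] for the
   remaining indices. *)
Definition mutually_independent {d} {T : measurableType d} {R : realType}
    (P : probability T R) (n : nat) (X : 'I_n -> T -> R) : Prop :=
  forall A : 'I_n -> set R, (forall i, measurable (A i)) ->
    P (\bigcap_i (X i @^-1` A i)) = (\prod_(i < n) P (X i @^-1` A i))%E.

(* The process is indexed by [0, +oo[: nothing is required of [B t] for
   t < 0.  The law of the increments is stated for s < t only, because
   [normal_prob m 0] is not the Dirac mass at m. *)
Definition brownian_motion {d} {T : measurableType d} {R : realType}
    (P : probability T R) (B : R -> {RV P >-> R}) : Prop :=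
  [/\ {ae P, forall w, B 0 w = 0},
      (forall t : nat -> R, 0 <= t 0%N -> nondecreasing_seq t ->
        forall n : nat,
          mutually_independent P (fun i : 'I_n => B (t i.+1) \- B (t i))),
      (forall s t : R, 0 <= s -> s < t ->
        forall A : set R, measurable A ->
          P ((B t \- B s) @^-1` A) = normal_prob 0 (Num.sqrt (t - s)) A) &
      {ae P, forall w, {within `[0, +oo[, continuous (fun t => B t w)}}].

Arguments brownian_motion {d T R} P B.

(* The library norm on [R * R] is the maximum norm. *)
Definition dot {R : realType} (x y : R * R) : R := x.1 * y.1 + x.2 * y.2.

Definition enorm {R : realType} (x : R * R) : R := Num.sqrt (dot x x).

Definition ediam {R : realType} (U : set (R * R)) : \bar R :=
  ereal_sup [set (enorm (p.1 - p.2))%:E | p in U `*` U].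

Definition graph {R : realType} (f : R -> R) (E : set R) : set (R * R) :=
  [set (t, f t) | t in E].

(* The test on [U] matters for s = 0 only, where a point has weight 1 and the
   empty set weight 0; the supremum defining [ediam set0] is -oo. *)
Definition hausdorff_weight {R : realType} (s : R) (U : set (R * R)) : \bar R :=
  if pselect (U = set0) then 0%E else (ediam U `^ s)%E.

Definition hausdorff_content {R : realType} (s delta : R) (E : set (R * R)) :
    \bar R :=
  ereal_inf [set (\sum_(0 <= i <oo) hausdorff_weight s (U i))%E |
    U in [set U : nat -> set (R * R) |
      E `<=` \bigcup_i U i /\ forall i, (ediam (U i) <= delta%:E)%E]].

Definition hausdorff_measure {R : realType} (s : R) (E : set (R * R)) :
    \bar R :=
  ereal_sup [set hausdorff_content s delta E | delta in [set x | 0 < x]].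

Definition hausdorff_dim {R : realType} (E : set (R * R)) : \bar R :=
  ereal_inf [set s%:E | s in [set s | 0 <= s /\ hausdorff_measure s E = 0%E]].

Definition expi {R : realType} (theta : R) : R[i] := cos theta +i* sin theta.

Definition cintegral {d} {T : measurableType d} {R : realType}
    (mu : {measure set T -> \bar R}) (f : T -> R[i]) : R[i] :=
  (\int[mu]_x complex.Re (f x))%R +i* (\int[mu]_x complex.Im (f x))%R.

Definition fourier_transform {R : realType}
    (mu : {finite_measure set (R * R)%type -> \bar R}) (xi : R * R) : R[i] :=
  cintegral mu (fun x => expi (- (2 * pi * dot xi x))).

(* [mu.-negligible (~` E)] is [mu (~` E) = 0] for Borel E. *)
Definition fourier_dim {R : realType} (E : set (R * R)) : \bar R :=
  ereal_sup [set alpha%:E | alpha in [set alpha : R | 0 <= alpha /\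
    exists mu : {finite_measure set (R * R)%type -> \bar R},
      [/\ mu setT != 0%E, mu.-negligible (~` E) &
          exists C : R, forall xi : R * R, xi != 0 ->
            Normc.normc (fourier_transform mu xi)
              <= C * enorm xi `^ (- (alpha / 2))]]].

(* Main.v *)
Require Import Defs.
From HB Require Import structures.
From mathcomp Require Import all_boot all_order all_algebra.
From mathcomp Require Import complex.
From mathcomp Require Import all_classical all_reals all_analysis.
From mathcomp Require Import measurable_realfun ring lra.

Import Order.TTheory GRing.Theory Num.Theory.
Import numFieldNormedType.Exports.

Local Open Scope classical_set_scope.
Local Open Scope ring_scope.

(** Put s0 = 1 + ln 2 / (2 * ln 3), V for the Cantor function, q for the square
root of 1/2 and G for the graph of B \o V; note that 3^s0 = 3 / q.

Fourier dimension: this half is deterministic.  Let mu be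
a finite measure on G whose transform tends to 0.  By Wiener's argument
([wiener_no_mass]) mu gives no mass to a horizontal line
([decay_no_horizontal_line]).  If some 3^k * t lies strictly in a middle third
modulo 1, then V t is rational ([cantor_gap_rational]), so the point of G above
t lies on one of countably many horizontal lines.  Hence for mu-almost every
(t, y) and all k one has cos (2 pi 3^k t) >= -1/2: the projection of mu lives on
the Cantor set, which is a set of uniqueness.  Concretely, a trigonometric
polynomial p with mean 1/4 is nonpositive wherever the cosine is at least -1/2;
integrating p (3^k t) and letting k tend to infinity gives mu(setT) <= 0
([decay_ternary_mass]).

Upper bound: Gaussian tails and Borel-Cantelli bound the dyadic increments of B
of level m by a multiple of (m + 1) * q^m, and chaining turns this into a modulus
of continuity ([dyadic_chaining]).  Of the 3^n triadic intervals of length 3^-n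
at most 2^n carry a nonconstant V ([size_not_flat]), and over each of these G
needs about n * q^n * 3^n squares of side 3^-n.  The other intervals need one
square each.  So G is covered by about n * (6 * q)^n squares, and 6 * q = 3^s0
([graph_hausdorff_measure0]).

Lower bound: sample G at 2^N points where V equals j / 2^N, and let the energy of
the sample count the pairs at distance at most 3^-n with weight b^n, b = 3^gamma.
Two such points have parameters u, v with |u - v| <= 2^-n, and B_u, B_v are then
3^-n close with probability at most 3^-n / |u - v|^(1/2).  Hence the expected
energy is bounded uniformly in N as soon as gamma < s0
([expected_graph_energy]), and by Fatou's lemma the energy of almost every path
stays bounded along infinitely many N ([ae_energy_bounded_often]).  Bounded
energy forbids covers of small total weight: many of the sample points would
share a small set ([energy_partition], [graph_hausdorff_measure_neq0]).  Samples
replace the energy integral, so that compactness and finite sums do the work of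
joint measurability. *)

(** * The Cantor function *)

Lemma cantor_iter_bounds (R : realType) (n : nat) (x : R) :
  0 <= x <= 1 -> 0 <= cantor_iter n x <= 1.
Proof.
elim: n x => [//|n IH] x hx /=.
case: ifPn => h1; first by have := IH (3 * x) ltac:(lra); lra.
case: ifPn => h2; first by lra.
by have := IH (3 * x - 2) ltac:(lra); lra.
Qed.

(** The iterates are affine copies of one another at scale 1/2, so the error
halves at each step of the recursion. *)
Lemma cantor_iter_cauchy (R : realType) (n m : nat) (x : R) :
  0 <= x <= 1 -> `|cantor_iter (n + m) x - cantor_iter n x| <= (1 / 2) ^+ n.
Proof.
elim: n x => [|n IH] x hx.
  rewrite add0n expr0 ler_norml.
  by have /= := cantor_iter_bounds R m x hx; lra.
rewrite addSn /= exprS.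
case: ifPn => h1.
  have := IH (3 * x) ltac:(lra); rewrite !ler_norml; lra.
case: ifPn => h2.
  by rewrite subrr normr0; have := exprn_ge0 n (_ : 0 <= 1 / 2 :> R); lra.
have := IH (3 * x - 2) ltac:(lra); rewrite !ler_norml; lra.
Qed.

Lemma exprn_small (R : realType) (z e : R) :
  0 <= z < 1 -> 0 < e -> exists N, forall n, (N <= n)%N -> z ^+ n < e.
Proof.
move=> /andP[z0 z1] e0.
have h : `|z| < 1 by rewrite ger0_norm.
have /cvgrPdist_lt/(_ e e0)[N _ hN] := cvg_expr h.
exists N => n /hN; rewrite sub0r normrN ger0_norm ?exprn_ge0 //.
Qed.

Lemma cantor_iter_cvg (R : realType) (x : R) :
  0 <= x <= 1 -> (fun n => cantor_iter n x) @ \oo --> cantor_function x.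
Proof.
move=> hx.
suff : cvgn (fun n => cantor_iter n x) by [].
apply/cauchy_cvgP/cauchy_exP => e e0.
have [N hN] := exprn_small R (1 / 2) e ltac:(lra) e0.
exists (cantor_iter N x); exists N => // n /= Nn.
rewrite /ball /= distrC -(subnKC Nn).
exact: le_lt_trans (cantor_iter_cauchy _ _ _ _ hx) (hN N (leqnn N)).
Qed.

Lemma cantor_left (R : realType) (x : R) :
  0 <= x <= 1 / 3 -> cantor_function x = cantor_function (3 * x) / 2.
Proof.
move=> hx; rewrite {1}/cantor_function; apply/cvg_lim => //.
rewrite -(cvg_shiftS (fun n => cantor_iter n x)) /=.
have -> : x <= 1 / 3 by lra.
apply: cvgM; [apply: cantor_iter_cvg; lra | exact: cvg_cst].
Qed.

Lemma cantor_mid (R : realType) (x : R) :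
  1 / 3 < x < 2 / 3 -> cantor_function x = 1 / 2.
Proof.
move=> hx; rewrite {1}/cantor_function; apply/cvg_lim => //.
rewrite -(cvg_shiftS (fun n => cantor_iter n x)) /=.
have /negbTE -> : ~~ (x <= 1 / 3) by lra.
have -> : x < 2 / 3 by lra.
exact: cvg_cst.
Qed.

Lemma cantor_right (R : realType) (x : R) :
  2 / 3 <= x <= 1 -> cantor_function x = 1 / 2 + cantor_function (3 * x - 2) / 2.
Proof.
move=> hx; rewrite {1}/cantor_function; apply/cvg_lim => //.
rewrite -(cvg_shiftS (fun n => cantor_iter n x)) /=.
have /negbTE -> : ~~ (x <= 1 / 3) by lra.
have /negbTE -> : ~~ (x < 2 / 3) by lra.
apply: cvgD; first exact: cvg_cst.
by apply: cvgM; [apply: cantor_iter_cvg; lra | exact: cvg_cst].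
Qed.

Lemma cantor_bounds (R : realType) (x : R) :
  0 <= x <= 1 -> 0 <= cantor_function x <= 1.
Proof.
move=> hx; apply/andP; split.
  apply: limr_ge; first exact: cantor_iter_cvg.
  by apply: nearW => n; case/andP: (cantor_iter_bounds R n x hx).
apply: limr_le; first exact: cantor_iter_cvg.
by apply: nearW => n; case/andP: (cantor_iter_bounds R n x hx).
Qed.

Lemma cantor0 (R : realType) : cantor_function (0 : R) = 0.
Proof. by have := cantor_left R 0 ltac:(lra); rewrite mulr0; lra. Qed.

Lemma cantor1 (R : realType) : cantor_function (1 : R) = 1.
Proof.
have := cantor_right R 1 ltac:(lra).
have -> : 3 * 1 - 2 = 1 :> R by ring.
lra.
Qed.


Lemma cantor_mid_closed (R : realType) (x : R) :
  1 / 3 <= x <= 2 / 3 -> cantor_function x = 1 / 2.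
Proof.
move=> hx; have [x1|x1] := leP x (1 / 3).
  have -> : x = 1 / 3 by lra.
  rewrite cantor_left; last by lra.
  by rewrite mulrCA divff ?mulr1 ?cantor1 // pnatr_eq0.
have [x2|x2] := ltP x (2 / 3); first by apply: cantor_mid; lra.
rewrite cantor_right; last by lra.
have -> : 3 * x - 2 = 0 by lra.
by rewrite cantor0; lra.
Qed.

(** The recursion with closed conditions: the three formulas agree at 1/3 and 2/3. *)
Lemma cantor_third_cases (R : realType) (x : R) : 0 <= x <= 1 ->
  [\/ x <= 1 / 3 /\ cantor_function x = cantor_function (3 * x) / 2,
      1 / 3 <= x <= 2 / 3 /\ cantor_function x = 1 / 2 |
      2 / 3 <= x /\ cantor_function x = 1 / 2 + cantor_function (3 * x - 2) / 2].
Proof.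
move=> hx; have [x1|x1] := leP x (1 / 3).
  by apply: Or31; split=> //; apply: cantor_left; lra.
have [x2|x2] := ltP x (2 / 3).
  by apply: Or32; split; [lra | apply: cantor_mid; lra].
by apply: Or33; split=> //; apply: cantor_right; lra.
Qed.

Lemma cantor_mono (R : realType) (s t : R) :
  0 <= s -> s <= t -> t <= 1 -> cantor_function s <= cantor_function t.
Proof.
have claim n (x y : R) : 0 <= x -> x <= y -> y <= 1 ->
    cantor_function x <= cantor_function y + (1 / 2) ^+ n.
  elim: n x y => [|n IH] x y x0 xy y1.
    by have := cantor_bounds R x ltac:(lra); have := cantor_bounds R y ltac:(lra); lra.
  have e0 : 0 <= (1 / 2 : R) ^+ n by apply: exprn_ge0; lra.
  rewrite exprS.
  have [[h1 ->]|[h1 ->]|[h1 ->]] := cantor_third_cases R x ltac:(lra);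
  have [[h2 ->]|[h2 ->]|[h2 ->]] := cantor_third_cases R y ltac:(lra).
  - by have := IH (3 * x) (3 * y) ltac:(lra) ltac:(lra) ltac:(lra); lra.
  - by have := cantor_bounds R (3 * x) ltac:(lra); lra.
  - by have := cantor_bounds R (3 * x) ltac:(lra);
       have := cantor_bounds R (3 * y - 2) ltac:(lra); lra.
  - have -> : 3 * y = 1 by lra.
    by rewrite cantor1; lra.
  - lra.
  - by have := cantor_bounds R (3 * y - 2) ltac:(lra); lra.
  - lra.
  - have -> : 3 * x - 2 = 0 by lra.
    by rewrite cantor0; lra.
  - by have := IH (3 * x - 2) (3 * y - 2) ltac:(lra) ltac:(lra) ltac:(lra); lra.
move=> s0 st t1; apply/ler_addgt0Pr => e e0.
have [N hN] := exprn_small R (1 / 2) e ltac:(lra) e0.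
by apply: le_trans (claim N s t s0 st t1) _; rewrite lerD2l ltW ?hN.
Qed.

(** Proved by descending n ternary digits: both ends in the same outer third is
the scaled statement, and an end in the middle third may be moved to its boundary. *)
Lemma cantor_modulus (R : realType) (n : nat) (s t : R) :
  0 <= s -> s <= t -> t <= 1 -> t - s <= (1 / 3) ^+ n ->
  cantor_function t - cantor_function s <= (1 / 2) ^+ n.
Proof.
elim: n s t => [|n IH] s t s0 st t1 hd.
  by have := cantor_bounds R s ltac:(lra); have := cantor_bounds R t ltac:(lra); lra.
have e0 : 0 <= (1 / 2 : R) ^+ n by apply: exprn_ge0; lra.
have d1 : (1 / 3 : R) ^+ n <= 1 by apply: exprn_ile1; lra.
move: hd; rewrite !exprS => hd.
have [[h1 ->]|[h1 ->]|[h1 ->]] := cantor_third_cases R s ltac:(lra);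
have [[h2 ->]|[h2 ->]|[h2 ->]] := cantor_third_cases R t ltac:(lra).
- by have := IH (3 * s) (3 * t) ltac:(lra) ltac:(lra) ltac:(lra) ltac:(lra); lra.
- by have := IH (3 * s) 1 ltac:(lra) ltac:(lra) ltac:(lra) ltac:(lra); rewrite cantor1; lra.
- have -> : 3 * s = 1 by lra.
  have -> : 3 * t - 2 = 0 by lra.
  by rewrite cantor0 cantor1; lra.
- have -> : 3 * t = 1 by lra.
  by rewrite cantor1; lra.
- lra.
- by have := IH 0 (3 * t - 2) ltac:(lra) ltac:(lra) ltac:(lra) ltac:(lra); rewrite cantor0; lra.
- lra.
- have -> : 3 * s - 2 = 0 by lra.
  by rewrite cantor0; lra.
- by have := IH (3 * s - 2) (3 * t - 2) ltac:(lra) ltac:(lra) ltac:(lra) ltac:(lra); lra.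
Qed.

Lemma cantor_dist (R : realType) (n : nat) (s t : R) :
  0 <= s <= 1 -> 0 <= t <= 1 -> `|t - s| <= (1 / 3) ^+ n ->
  `|cantor_function t - cantor_function s| <= (1 / 2) ^+ n.
Proof.
wlog st : s t / s <= t => [hw hs ht hd|hs ht hd].
  have [st|/ltW ts] := leP s t; first exact: hw.
  by rewrite distrC; apply: hw => //; rewrite distrC.
rewrite ger0_norm; last by rewrite subr_ge0; apply: cantor_mono; lra.
apply: cantor_modulus; try lra.
by rewrite -[t - s]ger0_norm // subr_ge0.
Qed.

Lemma cantor_surj_dyadic (R : realType) (n j : nat) : (j <= 2 ^ n)%N ->
  exists2 t : R, 0 <= t <= 1 & cantor_function t = j%:R / 2 ^+ n.
Proof.
elim: n j => [|n IH] j.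
  case: j => [|[|//]] _.
    by exists 0; [lra | rewrite cantor0 mul0r].
  by exists 1; [lra | rewrite cantor1 expr0 divr1].
have p0 : 0 < (2 : R) ^+ n by apply: exprn_gt0; lra.
have [jn _|nj jn] := leqP j (2 ^ n).
  have [t t01 Vt] := IH j jn.
  exists (t / 3); first by lra.
  rewrite cantor_left; last by lra.
  have -> : 3 * (t / 3) = t by lra.
  by rewrite Vt exprSr invfM mulrA.
have [|t t01 Vt] := IH (j - 2 ^ n)%N.
  by rewrite leq_subLR addnn -mul2n -expnS.
exists ((t + 2) / 3); first by lra.
rewrite cantor_right; last by lra.
have -> : 3 * ((t + 2) / 3) - 2 = t by lra.
rewrite Vt natrB ?(ltnW nj) // natrX exprSr.
by field; rewrite gt_eqF.
Qed.

(** By self-similarity a triadic interval is either inside a gap or carries a full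
copy of the function; together with the total increment 1 this counts the
nonflat intervals. *)
Lemma cantor_triadic (R : realType) (n i : nat) : (i < 3 ^ n)%N ->
  let D := cantor_function (i.+1%:R / 3 ^+ n) - cantor_function (i%:R / 3 ^+ n) : R in
  D = 0 \/ D = (1 / 2) ^+ n.
Proof.
elim: n i => [|n IH] i /=.
  rewrite expn0 ltnS leqn0 => /eqP ->.
  by rewrite !expr0 !divr1 cantor0 cantor1 subr0; right.
have p0 : 0 < (3 : R) ^+ n by apply: exprn_gt0; lra.
have e3 : ((3 ^ n)%:R = 3 ^+ n :> R) by rewrite natrX.
have eS k : k.+1%:R = k%:R + 1 :> R by rewrite -natr1.
have hdiv (k : nat) : k%:R / 3 ^+ n.+1 = k%:R / 3 ^+ n / 3 :> R.
  by rewrite exprSr invfM mulrA.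
move=> hi; rewrite !hdiv.
have hle (a b : nat) : (a <= b)%N -> a%:R / 3 ^+ n <= b%:R / 3 ^+ n :> R.
  by move=> ab; rewrite ler_pM2r ?invr_gt0 // ler_nat.
have hge (k : nat) : 0 <= k%:R / 3 ^+ n :> R by apply: divr_ge0 => //; apply: ltW.
have hfull k : (k * 3 ^ n)%:R / 3 ^+ n = k%:R :> R.
  by rewrite natrM e3 mulfK // gt_eqF.
have hub (a k : nat) : (a <= k * 3 ^ n)%N -> a%:R / 3 ^+ n <= k%:R :> R.
  by move=> ak; rewrite -hfull hle.
have hlb (a k : nat) : (k * 3 ^ n <= a)%N -> k%:R <= a%:R / 3 ^+ n :> R.
  by move=> ak; rewrite -hfull hle.
have VL (x : R) : 0 <= x <= 1 -> cantor_function (x / 3) = cantor_function x / 2.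
  by move=> hx; rewrite cantor_left; [congr (cantor_function _ / 2); lra | lra].
have VR (x : R) : 0 <= x <= 1 ->
    cantor_function ((x + 2) / 3) = 1 / 2 + cantor_function x / 2.
  move=> hx; rewrite cantor_right; last by lra.
  by congr (_ + cantor_function _ / 2); lra.
have [i1|i1] := ltnP i (3 ^ n).
  have u0 := hub i 1%N ltac:(by rewrite mul1n ltnW).
  have u1 := hub i.+1 1%N ltac:(by rewrite mul1n).
  rewrite !VL ?hge ?u0 ?u1 // exprS -mulrBl mulrC.
  by have [->|->] := IH i i1; [left; rewrite mulr0 | right; rewrite mul1r].
have [i2|i2] := ltnP i (2 * 3 ^ n).
  left; have u1 := hub i.+1 2%N i2; have l0 := hlb i 1%N ltac:(by rewrite mul1n).
  have a2 := hle _ _ (leqnSn i).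
  by rewrite !cantor_mid_closed ?subrr //;
    move: u1 l0 a2; move: (i.+1%:R / _) (i%:R / _) => x y; lra.
have [k ik] : exists k, i = (k + 2 * 3 ^ n)%N by exists (i - 2 * 3 ^ n)%N; rewrite subnK.
have k3 : (k < 3 ^ n)%N.
  by move: hi; rewrite ik expnS (_ : 3 * _ = 3 ^ n + 2 * 3 ^ n)%N ?ltn_add2r // -mulSn.
have s2 : i.+1%:R / 3 ^+ n = k.+1%:R / 3 ^+ n + 2 :> R.
  by rewrite ik -addSn natrD mulrDl hfull.
have s1 : i%:R / 3 ^+ n = k%:R / 3 ^+ n + 2 :> R by rewrite ik natrD mulrDl hfull.
have u0 := hub k 1%N ltac:(by rewrite mul1n ltnW).
have u1 := hub k.+1 1%N ltac:(by rewrite mul1n).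
rewrite s1 s2 !VR ?hge ?u0 ?u1 // addrAC opprD addrA addrN add0r exprS.
rewrite addrC -mulrBl mulrC.
by have [->|->] := IH k k3; [left; rewrite mulr0 | right; rewrite mul1r].
Qed.

(** The angle solves cos (2 a) = cos a, because 2 a and - a differ by a full turn. *)
Lemma cos_third (R : realType) : cos (2 * pi / 3 : R) = - (1 / 2).
Proof.
have pi0 := pi_gt0 R.
set a := (2 * pi / 3 : R).
have h2 : cos (a *+ 2) = cos a.
  have -> : a *+ 2 = - a + pi *+ 2 by rewrite /a; lra.
  by rewrite cosD2pi cosN.
have h1 : cos a < 1.
  rewrite -(cos0 R) ltr_cos ?in_itv /=; rewrite /a; lra.
have /eqP : (cos a - 1) * (cos a + 1 / 2) = 0.
  by move: h2; rewrite cos_mulr2n => h; lra.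
by rewrite mulf_eq0 => /orP[] /eqP; lra.
Qed.

Lemma cos_ge_Nhalf (R : realType) (x : R) :
  0 <= x <= 1 / 3 -> - (1 / 2) <= cos (2 * pi * x).
Proof.
move=> hx; have pi0 := pi_gt0 R.
have h0 : 0 <= pi * x by apply: mulr_ge0; lra.
have h1 : pi * x <= pi * (1 / 3) by rewrite ler_pM2l //; lra.
have [->|hlt] := eqVneq x (1 / 3).
  by have := cos_third R; rewrite (_ : 2 * pi * (1 / 3) = 2 * pi / 3); lra.
have h2 : pi * x < pi * (1 / 3) by rewrite ltr_pM2l // lt_neqAle hlt; lra.
rewrite -cos_third ltW // ltr_cos ?in_itv /=; lra.
Qed.

Lemma cosD2pin (R : realType) (x : R) (n : nat) : cos (x + 2 * pi * n%:R) = cos x.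
Proof.
elim: n => [|n IH]; first by rewrite mulr0 addr0.
rewrite -[RHS]IH -[in RHS]cosD2pi -natr1 -mulr_natl.
by congr cos; ring.
Qed.

(** The cosine condition encodes that 3^k x lies in an open middle third modulo 1.
It is invariant under the two expanding branches x |-> 3 x and x |-> 3 x - 2,
which makes the induction on k immediate. *)
Lemma cantor_gap_rational (R : realType) (k : nat) (x : R) : 0 <= x <= 1 ->
  cos (2 * pi * (3 ^+ k * x)) < - (1 / 2) ->
  exists q : rat, cantor_function x = ratr q.
Proof.
elim: k x => [|k IH] x hx.
  rewrite expr0 mul1r => hc; exists (1 / 2).
  rewrite rmorphM /= fmorphV rmorph1 rmorph_nat cantor_mid //.
  apply/andP; split; rewrite ltNge; apply/negP => h.
    by have := cos_ge_Nhalf R x ltac:(lra); lra.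
  have := cos_ge_Nhalf R (1 - x) ltac:(lra).
  have -> : 2 * pi * (1 - x) = - (2 * pi * x) + 2 * pi * 1%:R by ring.
  by rewrite cosD2pin cosN; lra.
rewrite exprSr => hc.
have [[h1 ->]|[h1 ->]|[h1 ->]] := cantor_third_cases R x hx.
- have [|q ->] := IH (3 * x) ltac:(lra); first by rewrite [_ * (3 * x)]mulrA.
  by exists (q / 2); rewrite rmorphM /= fmorphV rmorph_nat.
- by exists (1 / 2); rewrite rmorphM /= fmorphV rmorph1 rmorph_nat.
- have [|q ->] := IH (3 * x - 2) ltac:(lra).
    have h2 : 3 ^+ k * x * 3 = 3 ^+ k * (3 * x - 2) + (3 ^ k * 2)%:R.
      by rewrite natrM natrX; ring.
    by move: hc; rewrite [_ * 3 * x]mulrAC h2 mulrDr cosD2pin.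
  exists (1 / 2 + q / 2).
  by rewrite rmorphD /= !fmorph_div /= !rmorph_nat !rmorph1.
Qed.

(** * Integrals of bounded functions and the mass of a level set *)

Section bounded_measurable.
Context {d : measure_display} {T : measurableType d} {R : realType}.
Variable mu : {finite_measure set T -> \bar R}.
Implicit Types f g : T -> R.

(** A class of integrands that is closed under sums and products and integrable for
every finite measure, so that linearity of the integral needs no side conditions. *)
Definition bounded_measurable f :=
  measurable_fun setT f /\ exists M : R, forall x, `|f x| <= M.

Lemma bounded_measurable_integrable f :
  bounded_measurable f -> mu.-integrable setT (EFin \o f).
Proof.
move=> [mf [M hM]]; apply: measurable_bounded_integrable => //.
  by rewrite -ge0_fin_numE // fin_num_measure.
exists M; split; first exact: num_real.
by move=> N MN x _ /=; apply: le_trans (hM x) (ltW MN).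
Qed.

Lemma bounded_measurableD f g : bounded_measurable f -> bounded_measurable g ->
  bounded_measurable (fun x => f x + g x).
Proof.
move=> [mf [M hM]] [mg [N hN]]; split; first exact: measurable_funD.
by exists (M + N) => x; apply: le_trans (ler_normD _ _) _; apply: lerD.
Qed.

Lemma bounded_measurableM f g : bounded_measurable f -> bounded_measurable g ->
  bounded_measurable (fun x => f x * g x).
Proof.
move=> [mf [M hM]] [mg [N hN]]; split; first exact: measurable_funM.
by exists (M * N) => x; rewrite normrM ler_pM.
Qed.

Lemma bounded_measurable_cst (c : R) : bounded_measurable (fun=> c).
Proof. by split; [exact: measurable_cst | exists `|c|]. Qed.

Lemma bounded_measurable_cos (h : T -> R) : measurable_fun setT h ->
  bounded_measurable (fun x => cos (h x)).
Proof.
move=> mh; split.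
  apply: (measurableT_comp (f := cos)) => //.
  apply: continuous_measurable_fun; exact: continuous_cos.
exists 1 => x; rewrite ler_norml cos_geN1 cos_le1 //.
Qed.

Lemma bounded_measurable_sin (h : T -> R) : measurable_fun setT h ->
  bounded_measurable (fun x => sin (h x)).
Proof.
move=> mh; split.
  apply: (measurableT_comp (f := sin)) => //.
  apply: continuous_measurable_fun; exact: continuous_sin.
exists 1 => x; rewrite ler_norml sin_geN1 sin_le1 //.
Qed.

Lemma bounded_measurable_indic (A : set T) : measurable A ->
  bounded_measurable (\1_A).
Proof.
move=> mA; split; first exact: measurable_indic.
by exists 1 => x; rewrite ger0_norm ?indicE // ?lern1 ?leq_b1.
Qed.

Lemma RintD f g : bounded_measurable f -> bounded_measurable g ->
  \int[mu]_x (f x + g x) = \int[mu]_x f x + \int[mu]_x g x.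
Proof.
by move=> *; apply: RintegralD => //; apply: bounded_measurable_integrable.
Qed.

Lemma RintZ (c : R) f : bounded_measurable f ->
  \int[mu]_x (c * f x) = c * \int[mu]_x f x.
Proof.
by move=> *; apply: RintegralZl => //; apply: bounded_measurable_integrable.
Qed.

Lemma le_Rint f g : bounded_measurable f -> bounded_measurable g ->
  (forall x, f x <= g x) -> \int[mu]_x f x <= \int[mu]_x g x.
Proof.
by move=> *; apply: le_Rintegral => //; apply: bounded_measurable_integrable.
Qed.

Lemma Rint_indic (A : set T) : measurable A -> \int[mu]_x \1_A x = fine (mu A).
Proof. by move=> mA; rewrite /Rintegral integral_indic // setIT. Qed.

End bounded_measurable.

(** A finite Riesz product argument.  If g >= 0 equals 1 on the level set and the
integrals of g * cos (s z) tend to 0, then g * (1 + cos (s z)) / 2 has the same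
properties, and for large s about half the integral.  Iterating squeezes the
mass of the level set to 0. *)
Lemma wiener_no_mass {d} {T : measurableType d} {R : realType}
    (mu : {finite_measure set T -> \bar R}) (z : T -> R) :
  measurable_fun setT z ->
  (forall e, 0 < e -> exists s0, forall s, s0 <= s ->
     `|\int[mu]_x cos (s * z x)| <= e) ->
  mu (z @^-1` [set 0]) = 0%E.
Proof.
move=> mz decay.
set A := z @^-1` [set 0].
have mA : measurable A by rewrite -[A]setTI; exact: mz.
suff : ~ (0 < fine (mu A)).
  move=> h; have fA := fin_num_measure mu A mA.
  apply/eqP; rewrite -(fineK fA) eqe eq_le fine_ge0 // andbT leNgt; exact/negP.
set m := fine (mu A) => m0.
(* Integrals of functions in this class dominate m; step keeps the class and
   multiplies the integral by at most 3/4. *)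
pose P g := [/\ bounded_measurable g, (forall x, 0 <= g x),
  (forall x, A x -> g x = 1) &
  forall e, 0 < e -> exists s0, forall s, s0 <= s ->
     `|\int[mu]_x (g x * cos (s * z x))| <= e].
have mcos s : bounded_measurable (fun x => cos (s * z x)).
  apply: bounded_measurable_cos; apply: measurable_funM => //.
have Pm g : P g -> m <= \int[mu]_x g x.
  move=> [bg g0 g1 _]; rewrite /m -Rint_indic //.
  apply: le_Rint => //; first exact: bounded_measurable_indic.
  move=> x; rewrite indicE; have [/set_mem Ax|_] := boolP (x \in A).
    by rewrite g1.
  exact: g0.
have step g : P g -> exists2 g', P g' &
    \int[mu]_x g' x <= 3 / 4 * \int[mu]_x g x.
  move=> Pg; have := Pg => -[bg g0 g1 dg].
  have [s hs] := dg (m / 2) ltac:(lra).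
  (* g' = g * (1 + cos (s z)) / 2 for a large frequency s *)
  pose g' x := (1 / 2) * g x + (1 / 2) * (g x * cos (s * z x)).
  have bgc r : bounded_measurable (fun x => g x * cos (r * z x)).
    exact: bounded_measurableM.
  have bZ (c : R) (f : T -> R) : bounded_measurable f -> bounded_measurable (fun x => c * f x).
    by move=> bf; apply: bounded_measurableM => //; exact: bounded_measurable_cst.
  exists g'; last first.
    rewrite /g' RintD ?RintZ //; try by apply: bZ.
    have := hs s (lexx s); rewrite ler_norml; have := Pm g Pg; lra.
  split.
  - by apply: bounded_measurableD; apply: bZ.
  - move=> x; rewrite /g' -mulrDr -[X in X + _]mulr1 -mulrDr.
    apply: mulr_ge0; first by lra.
    by apply: mulr_ge0 => //; have := cos_geN1 (s * z x); lra.
  - move=> x Ax; rewrite /g' g1 // (_ : z x = 0) // mulr0 cos0; lra.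
  - move=> e e0; have [r hr] := dg e e0.
    exists (r + `|s|) => t ht.
    have hs1 := ler_norm s; have hs2 : - s <= `|s| by rewrite -normrN ler_norm.
    have -> : \int[mu]_x (g' x * cos (t * z x)) =
        1 / 2 * \int[mu]_x (g x * cos (t * z x)) +
        (1 / 4 * \int[mu]_x (g x * cos ((t + s) * z x)) +
         1 / 4 * \int[mu]_x (g x * cos ((t - s) * z x))).
      rewrite -!RintZ // -!RintD //; try by [apply: bZ | apply: bounded_measurableD; apply: bZ].
      apply: eq_Rintegral => x _; rewrite /g'.
      by rewrite [(t + s) * _]mulrDl [(t - s) * _]mulrBl cosD cosB; lra.
    have := hr t ltac:(have := normr_ge0 s; lra).
    have := hr (t + s) ltac:(lra); have := hr (t - s) ltac:(lra).
    rewrite !ler_norml; lra.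
have P1 : P (fun=> 1).
  split=> //; first exact: bounded_measurable_cst.
  move=> e e0; have [s0 hs0] := decay e e0; exists s0 => s hs.
  by under eq_Rintegral do rewrite mul1r; exact: hs0.
have iterP n : exists2 g, P g & \int[mu]_x g x <= (3 / 4) ^+ n * fine (mu setT).
  elim: n => [|n [g Pg hg]].
    by exists (fun=> 1) => //; rewrite Rintegral_cst // mul1r expr0 mul1r.
  have [g' Pg' hg'] := step g Pg; exists g' => //.
  by apply: le_trans hg' _; rewrite exprS; lra.
have M0 : 0 <= fine (mu setT) by rewrite fine_ge0.
have [N hN] := exprn_small R (3 / 4) (m / (fine (mu setT) + 1)) ltac:(lra)
  ltac:(apply: divr_gt0; lra).
have [g Pg hg] := iterP N.
have := Pm g Pg; have := hN N (leqnn N); rewrite ltr_pdivlMr; last by lra.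
have := exprn_ge0 N (_ : 0 <= 3 / 4 :> R) => /(_ ltac:(lra)); lra.
Qed.

(** * The Fourier dimension of the graph *)

Lemma powRN_small (R : realType) (C a e : R) : 0 < a -> 0 < e ->
  exists2 s0, 0 < s0 & forall s, s0 <= s -> C * s `^ (- a) <= e.
Proof.
move=> a0 e0; set D := `|C| + 1.
have D0 : 0 < D by rewrite /D; have := normr_ge0 C; lra.
have q0 : 0 < D / e by apply: divr_gt0.
exists ((D / e) `^ (a^-1)); first exact: powR_gt0.
move=> s hs.
have s0 : 0 < s by apply: lt_le_trans hs; exact: powR_gt0.
have h : D / e <= s `^ a.
  rewrite -[leLHS](powRr1 (ltW q0)) -[X in _ `^ X](@mulVf _ a) ?gt_eqF // powRrM.
  by apply: ge0_ler_powR => //; rewrite ?nnegrE ?powR_ge0 ?ltW.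
have sa0 := powR_gt0 a s0.
rewrite powRN ler_pdivrMr //.
move: h; rewrite ler_pdivrMr // => h.
have := ler_norm C; rewrite /D in h; lra.
Qed.

Section fourier_decay.
Context {R : realType}.
Variable mu : {finite_measure set (R * R)%type -> \bar R}.

Lemma normr_le_sqrt_sum (a b : R) : `|a| <= Num.sqrt (a ^+ 2 + b ^+ 2).
Proof. by rewrite -sqrtr_sqr ler_wsqrtr // lerDl sqr_ge0. Qed.

Lemma normr_cos_integral_le (xi : R * R) :
  `|\int[mu]_x cos (2 * pi * dot xi x)| <= Normc.normc (fourier_transform mu xi).
Proof.
apply: le_trans (normr_le_sqrt_sum _ _); rewrite /=.
rewrite le_eqVlt; apply/orP; left; apply/eqP; congr `|_|.
by apply: eq_Rintegral => x _; rewrite cosN.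
Qed.

Lemma measurable_dot (xi : R * R) (c : R) :
  measurable_fun setT (fun x : R * R => c * dot xi x).
Proof.
apply: measurable_funM; first exact: measurable_cst.
by apply: measurable_funD; apply: measurable_funM.
Qed.

Lemma normr_sin_integral_le (xi : R * R) :
  `|\int[mu]_x sin (2 * pi * dot xi x)| <= Normc.normc (fourier_transform mu xi).
Proof.
rewrite /= addrC; apply: le_trans (normr_le_sqrt_sum _ _).
have -> : \int[mu]_x sin (- (2 * pi * dot xi x)) = - \int[mu]_x sin (2 * pi * dot xi x).
  rewrite -mulN1r -RintZ; last by apply: bounded_measurable_sin; exact: measurable_dot.
  by apply: eq_Rintegral => x _; rewrite sinN mulN1r.
by rewrite normrN.
Qed.

Hypothesis decay : forall e, 0 < e -> exists2 s0, 0 < s0 & forall xi : R * R,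
  s0 <= enorm xi -> Normc.normc (fourier_transform mu xi) <= e.

Lemma enorm1 (s : R) : enorm (s, 0) = `|s|.
Proof. by rewrite /enorm /dot /= mulr0 addr0 -expr2 sqrtr_sqr. Qed.

Lemma enorm2 (s : R) : enorm (0, s) = `|s|.
Proof. by rewrite /enorm /dot /= mulr0 add0r -expr2 sqrtr_sqr. Qed.

(** Apply [wiener_no_mass] to the height above the line: its cosine transform is a
combination of vertical Fourier coefficients of mu. *)
Lemma decay_no_horizontal_line (y0 : R) : mu [set x | x.2 = y0] = 0%E.
Proof.
have -> : [set x : R * R | x.2 = y0] = (fun x => x.2 - y0) @^-1` [set 0].
  apply/seteqP; split => x /=; first by move=> ->; rewrite subrr.
  by move/eqP; rewrite subr_eq0 => /eqP.
apply: wiener_no_mass.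
  by apply: measurable_funB => //; exact: measurable_snd.
move=> e e0; have [s0 s0p hs] := decay (e / 2) ltac:(lra).
have pi0 := pi_gt0 R.
exists (2 * pi * s0) => s h.
pose xi : R * R := (0, s / (2 * pi)).
have hdot x : 2 * pi * dot xi x = s * x.2.
  by rewrite /dot /= mul0r add0r mulrA mulrCA divff ?mulr1 // mulf_neq0 // gt_eqF.
have hxi : s0 <= enorm xi.
  rewrite enorm2; apply: le_trans (ler_norm _).
  by rewrite ler_pdivlMr ?mulr_gt0 // mulrC.
have hc := le_trans (normr_cos_integral_le xi) (hs xi hxi).
have hS := le_trans (normr_sin_integral_le xi) (hs xi hxi).
have -> : \int[mu]_x cos (s * (x.2 - y0)) =
   cos (s * y0) * \int[mu]_x cos (2 * pi * dot xi x) +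
   sin (s * y0) * \int[mu]_x sin (2 * pi * dot xi x).
  have bc := bounded_measurable_cos _ (measurable_dot xi (2 * pi)).
  have bs := bounded_measurable_sin _ (measurable_dot xi (2 * pi)).
  rewrite -!RintZ // -RintD //;
    try by apply: bounded_measurableM => //; exact: bounded_measurable_cst.
  by apply: eq_Rintegral => x _; rewrite hdot mulrBr cosB; ring.
apply: le_trans (ler_normD _ _) _; rewrite !normrM.
have c1 : `|cos (s * y0)| <= 1 by rewrite ler_norml cos_geN1 cos_le1.
have s1 : `|sin (s * y0)| <= 1 by rewrite ler_norml sin_geN1 sin_le1.
have := ler_pM (normr_ge0 _) (normr_ge0 _) c1 hc.
have := ler_pM (normr_ge0 _) (normr_ge0 _) s1 hS.
lra.
Qed.

(** The Cantor set is a set of uniqueness.  With c the cosine of 2 pi 3^k t, the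
polynomial - (c + 1/2) (1 - c)^2 is nonpositive when c >= -1/2, has mean 1/4 and
frequencies 3^k, 2 * 3^k and 3 * 3^k only; its oscillating part integrates to 0
in the limit. *)
Lemma decay_ternary_mass (N : set (R * R)) : mu.-negligible N ->
  (forall x k, ~ N x -> - (1 / 2) <= cos (2 * pi * (3 ^+ k * x.1))) ->
  mu setT = 0%E.
Proof.
move=> [N' [mN' N'0 NN']] hN.
set m := fine (mu setT).
have fT := fin_num_measure mu _ measurableT.
have M0 : 0 <= m by rewrite fine_ge0.
suff hm : forall e, 0 < e -> m <= 7 * e.
  apply/eqP; rewrite -(fineK fT) eqe eq_le M0 andbT -/m leNgt; apply/negP => m0.
  by have := hm (m / 14) ltac:(lra); lra.
move=> e e0; have [s0 s0p hs] := decay e e0.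
have [k hk] : exists k, s0 <= 3 ^+ k.
  have [k hk] := exprn_small R (1 / 3) (s0^-1) ltac:(lra) ltac:(by rewrite invr_gt0).
  exists k; have := hk k (leqnn k); rewrite expr_div_n expr1n div1r.
  by rewrite ltf_pV2 ?posrE ?exprn_gt0 // => /ltW.
have k0 : 0 < (3 : R) ^+ k by apply: exprn_gt0.
pose c (j : R) := \int[mu]_x cos (2 * pi * dot (j * 3 ^+ k, 0) x).
(* c j is the cosine transform at the horizontal frequency j * 3 ^+ k *)
have cj j : 1 <= j -> `|c j| <= e.
  move=> j1; apply: le_trans (normr_cos_integral_le _) (hs _ _).
  rewrite enorm1 ger0_norm; last by apply: mulr_ge0; lra.
  by apply: le_trans hk _; rewrite ler_peMl // ltW.
have h1 := cj 1 ltac:(lra); have h2 := cj 2 ltac:(lra); have h3 := cj 3 ltac:(lra).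
pose f1 (j : R) := fun x : R * R => cos (2 * pi * dot (j * 3 ^+ k, 0) x).
have b1 j : bounded_measurable (f1 j).
  by apply: bounded_measurable_cos; exact: measurable_dot.
have bZ (a : R) (f : R * R -> R) : bounded_measurable f -> bounded_measurable (fun x => a * f x).
  by move=> bf; apply: bounded_measurableM => //; exact: bounded_measurable_cst.
(* With cc the cosine of the angle, p is minus (cc + 1/2) * (1 - cc)^2. *)
pose p x := 1 / 4 + (- (3 / 4) * f1 1 x + (3 / 4 * f1 2 x + - (1 / 4) * f1 3 x)).
have bq : bounded_measurable (fun x => 3 / 4 * f1 2 x + - (1 / 4) * f1 3 x).
  by apply: bounded_measurableD; apply: bZ.
have br : bounded_measurable
    (fun x => - (3 / 4) * f1 1 x + (3 / 4 * f1 2 x + - (1 / 4) * f1 3 x)).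
  by apply: bounded_measurableD => //; apply: bZ.
have bp : bounded_measurable p.
  by apply: bounded_measurableD => //; exact: bounded_measurable_cst.
have ip : \int[mu]_x p x = 1 / 4 * m + (- (3 / 4) * c 1 + (3 / 4 * c 2 + - (1 / 4) * c 3)).
  rewrite RintD //; last exact: bounded_measurable_cst.
  rewrite RintD //; last exact: bZ.
  rewrite RintD //; try exact: bZ.
  by rewrite Rintegral_cst // !RintZ.
(* Off the null set p <= 0; on it the trivial bound p <= 2 suffices. *)
have mono : \int[mu]_x p x <= \int[mu]_x (2 * \1_N' x).
  apply: le_Rint => //; first by apply: bZ; exact: bounded_measurable_indic.
  move=> x; have hf j : f1 j x = cos (j * (2 * pi * (3 ^+ k * x.1))).
    by rewrite /f1 /dot /=; congr cos; ring.
  rewrite /p !hf [1 * (2 * pi * _)]mul1r; set th := 2 * pi * (3 ^+ k * x.1).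
  set cc := cos th.
  have e2 : cos (2 * th) = 2 * cc ^+ 2 - 1.
    by rewrite mulr_natl cos_mulr2n mulr_natl.
  have e3 : cos (3 * th) = 4 * cc ^+ 3 - 3 * cc.
    have -> : 3 * th = 2 * th + th by ring.
    have ss : sin th ^+ 2 = 1 - cc ^+ 2 by rewrite sin2cos2.
    have s2 : sin (2 * th) = 2 * cc * sin th.
      by rewrite [2 * th]mulr_natl sin_mulr2n -/cc; ring.
    rewrite cosD e2 s2 -/cc -[2 * cc * sin th * _]mulrA -expr2 ss; ring.
  rewrite e2 e3.
  have ub : cc <= 1 by exact: cos_le1.
  have lb : -1 <= cc by exact: cos_geN1.
  have -> : 1 / 4 + (- (3 / 4) * cc + (3 / 4 * (2 * cc ^+ 2 - 1) +
      - (1 / 4) * (4 * cc ^+ 3 - 3 * cc))) = - ((cc + 1 / 2) * (1 - cc) ^+ 2).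
    lra.
  rewrite indicE; have [xN|xN] := boolP (x \in N').
    rewrite mulr1; nra.
  have nx : ~ N x by move=> /NN'/mem_set; rewrite (negbTE xN).
  have hcc : - (1 / 2) <= cc := hN x k nx.
  rewrite mulr0 oppr_le0; apply: mulr_ge0; last exact: sqr_ge0.
  by lra.
move: mono; rewrite ip RintZ ?Rint_indic ?N'0 //=; last exact: bounded_measurable_indic.
move: h1 h2 h3; rewrite !ler_norml; lra.
Qed.

End fourier_decay.

(** A gap contributes a point on one of countably many horizontal lines, which carry
no mass; what remains is covered by [decay_ternary_mass]. *)
Lemma fourier_dim_graph_cantor (R : realType) (f : R -> R) :
  fourier_dim (graph (fun t => f (cantor_function t)) `[0, 1]) = 0%E.
Proof.
set G := graph _ _.
apply/eqP; rewrite eq_le; apply/andP; split; last first.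
  apply: ereal_sup_ubound; exists 0 => //; split => //.
  (* For exponent 0 a point mass on the graph will do. *)
  exists (dirac (0 : R, f 0)); split.
  - by rewrite /= diracE in_setT /= eqe oner_eq0.
  - exists (~` [set (0 : R, f 0)]).
    have m1 : measurable [set (0 : R, f 0)].
      have -> : [set (0 : R, f 0)] = [set 0] `*` [set f 0].
        by apply/seteqP; split=> [x ->|[a b] /= [-> ->]].
      by apply: measurableX; exact: measurable_set1.
    split; first exact: measurableC.
      by rewrite /= diracE memNset // => /(_ erefl).
    move=> x /= Gx xE; apply: Gx; exists 0; last by rewrite cantor0 xE.
    by rewrite /= in_itv /= lexx ler01.
  - exists 1 => xi _; rewrite mul0r oppr0 powRr0 mulr1.
    have mdot := measurable_dot xi (2 * pi).
    have mN : measurable_fun setT (fun x : R * R => - (2 * pi * dot xi x)).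
      exact: measurableT_comp.
    rewrite /fourier_transform /cintegral /Rintegral !integral_dirac //=; last 2 first.
    + by apply/measurable_EFinP; exact: (bounded_measurable_sin _ mN).1.
    + by apply/measurable_EFinP; exact: (bounded_measurable_cos _ mN).1.
    by rewrite indicE in_setT !mul1r cos2Dsin2 sqrtr1.
apply: ge_ereal_sup => _ [a [a0 [mu [muT0 Gneg [C hC]]]] <-].
rewrite lee_fin leNgt; apply/negP => apos.
move/eqP: muT0; apply.
have decay : forall e, 0 < e -> exists2 s0, 0 < s0 & forall xi : R * R,
    s0 <= enorm xi -> Normc.normc (fourier_transform mu xi) <= e.
  move=> e e0; have [s0 s0p hs] := powRN_small R C (a / 2) e ltac:(lra) e0.
  exists s0 => // xi hxi.
  have xi0 : xi != 0.
    apply: contraTneq hxi => ->; rewrite -ltNge.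
    by rewrite (_ : 0 = (0, 0)) // enorm1 normr0.
  exact: le_trans (hC xi xi0) (hs _ hxi).
have lneg : mu.-negligible (\bigcup_(q : rat) [set x : R * R | x.2 = f (ratr q)]).
  pose F k := oapp (fun q : rat => [set x : R * R | x.2 = f (ratr q)]) set0 (unpickle k).
  have mline y : measurable [set x : R * R | x.2 = y].
    have := @measurable_snd _ _ R R measurableT [set y] (measurable_set1 y).
    by rewrite setTI.
  apply: (@negligibleS _ _ _ _ (\bigcup_k F k)).
    move=> x [q _ xq]; exists (pickle q); first exact: I.
    rewrite /F pickleK; exact: xq.
  apply: negligible_bigcup => k; rewrite /F.
  case: (unpickle k) => [q|] /=; last exact: negligible_set0.
  exists [set x | x.2 = f (ratr q)]; split => //.
  exact: (decay_no_horizontal_line mu decay).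
apply: (decay_ternary_mass mu decay _ (negligibleU Gneg lneg)) => x k.
move=> /not_orP[/contrapT [t t01 <-] nl] /=.
rewrite leNgt; apply/negP => hc.
have [q hq] := cantor_gap_rational R k t t01 hc.
by apply: nl; exists q => //=; rewrite hq.
Qed.

(** * Hausdorff content of sets covered by boxes *)

Lemma enorm_ge0 (R : realType) (x : R * R) : 0 <= enorm x.
Proof. exact: sqrtr_ge0. Qed.

Lemma enorm_ge1 (R : realType) (x : R * R) : `|x.1| <= enorm x.
Proof. by rewrite /enorm /dot -sqrtr_sqr ler_wsqrtr // expr2 lerDl -expr2 sqr_ge0. Qed.

Lemma enorm_ge2 (R : realType) (x : R * R) : `|x.2| <= enorm x.
Proof. by rewrite /enorm /dot -sqrtr_sqr ler_wsqrtr // expr2 lerDr -expr2 sqr_ge0. Qed.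

Lemma enorm_le (R : realType) (x : R * R) (h : R) :
  `|x.1| <= h -> `|x.2| <= h -> enorm x <= 2 * h.
Proof.
move=> h1 h2; have h0 := le_trans (normr_ge0 _) h1.
have hh0 : 0 <= 2 * h by lra.
rewrite /enorm /dot -[leRHS]ger0_norm // -sqrtr_sqr ler_wsqrtr //.
have a1 : x.1 * x.1 <= h * h.
  by rewrite -!expr2 -[x.1 ^+ 2]real_normK ?num_real // ler_sqr ?nnegrE.
have a2 : x.2 * x.2 <= h * h.
  by rewrite -!expr2 -[x.2 ^+ 2]real_normK ?num_real // ler_sqr ?nnegrE.
have a3 : 0 <= h * h by rewrite -expr2 sqr_ge0.
by rewrite expr2; lra.
Qed.

Lemma ediam_le (R : realType) (U : set (R * R)) (r : R) :
  (forall p q, U p -> U q -> enorm (p - q) <= r) -> (ediam U <= r%:E)%E.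
Proof.
by move=> h; apply: ge_ereal_sup => _ [[p q] [/= Up Uq] <-]; rewrite lee_fin h.
Qed.

Lemma ediam_ge (R : realType) (U : set (R * R)) p q :
  U p -> U q -> ((enorm (p - q))%:E <= ediam U)%E.
Proof. by move=> Up Uq; apply: ereal_sup_ubound; exists (p, q). Qed.

Lemma ediam_ge0 (R : realType) (U : set (R * R)) : U !=set0 -> (0 <= ediam U)%E.
Proof.
by move=> [p Up]; apply: le_trans _ (ediam_ge R U p p Up Up); rewrite lee_fin enorm_ge0.
Qed.

Lemma hausdorff_weight_ge0 (R : realType) (s : R) (U : set (R * R)) :
  (0 <= hausdorff_weight s U)%E.
Proof. by rewrite /hausdorff_weight; case: pselect => [//|?]; exact: poweR_ge0. Qed.

Lemma hausdorff_weight_le (R : realType) (s r : R) (U : set (R * R)) : 0 <= s ->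
  0 <= r -> (ediam U <= r%:E)%E -> (hausdorff_weight s U <= (r `^ s)%:E)%E.
Proof.
move=> s0 r0 hU; rewrite /hausdorff_weight; case: pselect => [?|U0].
  by rewrite lee_fin powR_ge0.
have /ediam_ge0 d0 : U !=set0 by apply/set0P/eqP.
rewrite -poweR_EFin; apply: gt0_ler_poweR => //.
  by rewrite in_itv /= d0 leey.
by rewrite in_itv /= lee_fin r0 leey.
Qed.

(** A cover is indexed by nat, so the list is padded with empty sets, which weigh 0. *)
Lemma hausdorff_content_boxes (R : realType) (s delta h : R) (E : set (R * R))
    (L : seq (R * R)) : 0 < s -> 0 <= h -> 2 * h <= delta ->
  (forall p, E p -> exists2 c, c \in L &
     c.1 <= p.1 <= c.1 + h /\ c.2 <= p.2 <= c.2 + h) ->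
  (hausdorff_content s delta E <= ((size L)%:R * (2 * h) `^ s)%:E)%E.
Proof.
move=> s0 h0 hd cov.
pose box (c : R * R) := [set p : R * R | c.1 <= p.1 <= c.1 + h /\ c.2 <= p.2 <= c.2 + h].
pose U k := if (k < size L)%N then box (nth (0, 0) L k) else set0.
have dbox c : (ediam (box c) <= (2 * h)%:E)%E.
  apply: ediam_le => p q [p1 p2] [q1 q2]; apply: enorm_le; rewrite /= ler_norml; lra.
have dU k : (ediam (U k) <= (2 * h)%:E)%E.
  rewrite /U; case: ifP => _; first exact: dbox.
  by apply: ediam_le => p q [].
apply: (@le_trans _ _ (\sum_(0 <= i <oo) hausdorff_weight s (U i))%E).
  apply: ereal_inf_lbound; exists U => //; split.
    move=> p /cov [c cL hc]; exists (index c L) => //.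
    by rewrite /U index_mem cL nth_index.
  by move=> i; apply: le_trans (dU i) _; rewrite lee_fin.
rewrite (nneseries_split 0 (size L)); last by move=> k _; exact: hausdorff_weight_ge0.
rewrite add0n eseries0 ?adde0; last first.
  move=> i hi _; rewrite /hausdorff_weight /U ltnNge hi /=.
  by case: pselect.
apply: (@le_trans _ _ (\sum_(0 <= i < size L) ((2 * h) `^ s)%:E)%E).
  by apply: lee_sum => i _; apply: hausdorff_weight_le => //; [exact: ltW | lra].
by rewrite sumEFin sumr_const_nat subn0 -[_ *+ size L]mulr_natl.
Qed.

Lemma hausdorff_content_ge0 (R : realType) (s delta : R) (E : set (R * R)) :
  (0 <= hausdorff_content s delta E)%E.
Proof.
apply: le_ereal_inf_tmp => _ [U _ <-]; apply: nneseries_ge0 => *.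
exact: hausdorff_weight_ge0.
Qed.

Lemma hausdorff_measure_eq0 (R : realType) (s : R) (E : set (R * R)) :
  (forall delta e, 0 < delta -> 0 < e -> (hausdorff_content s delta E <= e%:E)%E) ->
  hausdorff_measure s E = 0%E.
Proof.
move=> h; apply/eqP; rewrite eq_le; apply/andP; split.
  apply: ge_ereal_sup => _ [delta /= d0 <-].
  by apply/lee_addgt0Pr => e e0; rewrite add0e; exact: h.
apply: le_trans (hausdorff_content_ge0 R s 1 E) _.
by apply: ereal_sup_ubound; exists 1 => //=.
Qed.

(** The factor n + 1 is absorbed by one square root of r: the partial sums of
q^k dominate (n + 1) * q^n. *)
Lemma mulrn_geometric_small (R : realType) (r e : R) : 0 < r < 1 -> 0 < e ->
  exists N, forall n, (N <= n)%N -> n.+1%:R * r ^+ n < e.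
Proof.
move=> /andP[r0 r1] e0; set q := Num.sqrt r.
have qq : q ^+ 2 = r by rewrite sqr_sqrtr // ltW.
have q0 : 0 < q by rewrite sqrtr_gt0.
have q1 : q < 1 by rewrite -(sqrtr1 R) ltr_sqrt.
have b n : n.+1%:R * q ^+ n * (1 - q) <= 1 - q ^+ n.+1.
  elim: n => [|n IH]; first by rewrite expr0 expr1; lra.
  have p1 : q ^+ n.+1 <= 1 by rewrite exprn_ile1 // ltW.
  have p0 : 0 <= q ^+ n.+1 by rewrite exprn_ge0 // ltW.
  rewrite -natr1 [q ^+ n.+2]exprS.
  have : q * (n.+1%:R * q ^+ n * (1 - q)) <= q * (1 - q ^+ n.+1).
    by rewrite ler_pM2l.
  have -> : q * (n.+1%:R * q ^+ n * (1 - q)) = n.+1%:R * q ^+ n.+1 * (1 - q).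
    by rewrite exprS; ring.
  nra.
have [N hN] := exprn_small R q (e * (1 - q)) ltac:(lra) ltac:(apply: mulr_gt0; lra).
exists N => n /hN hq.
rewrite -qq -exprM mul2n -addnn exprD mulrA.
have := b n; have p0 : 0 < q ^+ n by rewrite exprn_gt0.
have p2 : 0 < q ^+ n.+1 by rewrite exprn_gt0.
move: hq p2; move: (n.+1%:R * q ^+ n) => y; move: (q ^+ n) (q ^+ n.+1) p0 => a c p0 hq p2 hy.
have : y * (1 - q) * a <= 1 * a by rewrite ler_pM2r //; lra.
rewrite mul1r => hh.
have : y * a * (1 - q) < e * (1 - q) by rewrite mulrAC; lra.
by rewrite ltr_pM2r //; lra.
Qed.

Lemma powR_exprn (R : realType) (x a : R) (n : nat) : 0 <= x ->
  (x ^+ n) `^ a = (x `^ a) ^+ n.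
Proof.
move=> x0; rewrite -(powR_mulrn n x0) -powRrM mulrC powRrM.
by rewrite powR_mulrn // powR_ge0.
Qed.

Lemma powR_expVn (R : realType) (x a : R) (n : nat) : 0 < x ->
  ((x ^+ n)^-1) `^ a = ((x `^ a) ^+ n)^-1.
Proof.
move=> x0; have xn0 : 0 <= x ^+ n by rewrite exprn_ge0 // ltW.
rewrite -powR_exprn; last exact: ltW.
by rewrite -(powR_inv1 xn0) -powRrM mulN1r powRN.
Qed.

(** * Upper bound: covering the graph *)

(** Equality of the end values suffices for constancy on the interval, because the
Cantor function is monotone. *)
Definition flat {R : realType} (n i : nat) : bool :=
  cantor_function (i.+1%:R / 3 ^+ n : R) == cantor_function (i%:R / 3 ^+ n : R).

(** Each nonflat interval contributes 2^-n to the total increment 1. *)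
Lemma size_not_flat (R : realType) (n : nat) :
  (size [seq i <- iota 0 (3 ^ n) | ~~ flat (R := R) n i])%:R <= 2 ^+ n :> R.
Proof.
pose D i : R := cantor_function (i.+1%:R / 3 ^+ n) - cantor_function (i%:R / 3 ^+ n).
have n0 : (3 ^+ n : R) != 0 by rewrite expf_neq0 ?pnatr_eq0.
have S : \sum_(0 <= i < 3 ^ n) D i = 1.
  rewrite (telescope_sumr (fun i => cantor_function (i%:R / 3 ^+ n : R))) //.
  by rewrite natrX divff // mul0r cantor1 cantor0 subr0.
have : (size [seq i <- iota 0 (3 ^ n) | ~~ flat (R := R) n i])%:R * (1 / 2) ^+ n <= 1 :> R.
  rewrite -[leRHS]S /index_iota subn0.
  have : {subset iota 0 (3 ^ n) <= [pred i | (i < 3 ^ n)%N]}.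
    by move=> i; rewrite mem_iota.
  elim: (iota 0 (3 ^ n)) => [|i s IH] sub /=; first by rewrite big_nil mul0r.
  rewrite big_cons.
  have := IH ltac:(by move=> j js; apply: sub; rewrite inE js orbT).
  have hi : (i < 3 ^ n)%N by apply: sub; rewrite mem_head.
  have p0 : 0 <= (1 / 2 : R) ^+ n by apply: exprn_ge0; lra.
  have hD : D i = 0 \/ D i = (1 / 2) ^+ n := cantor_triadic R n i hi.
  case: ifPn => /= hf.
    have -> : D i = (1 / 2) ^+ n.
      case: hD => // D0; move: hf; rewrite /flat.
      by move/eqP: D0; rewrite subr_eq0 => ->.
    by rewrite -natr1; lra.
  by case: hD => ->; lra.
have e1 : (1 / 2 : R) ^+ n = (2 ^+ n)^-1 by rewrite div1r exprVn.
by rewrite e1 ler_pdivrMr ?mul1r // exprn_gt0.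
Qed.

Lemma triadic_cell (R : realType) (n : nat) (t : R) : 0 <= t <= 1 ->
  exists2 i : nat, (i < 3 ^ n)%N & i%:R / 3 ^+ n <= t <= i.+1%:R / 3 ^+ n.
Proof.
move=> ht; have p0 : 0 < (3 : R) ^+ n by rewrite exprn_gt0.
have [->|t1] := eqVneq t 1.
  have p3 : (0 < 3 ^ n)%N by rewrite expn_gt0.
  exists (3 ^ n).-1; first by rewrite prednK.
  rewrite prednK // natrX divff ?gt_eqF // lexx andbT.
  by rewrite ler_pdivrMr // mul1r -natrX ler_nat leq_pred.
have tlt : t < 1 by rewrite lt_neqAle t1; lra.
have x0 : 0 <= t * 3 ^+ n by apply: mulr_ge0; [lra | exact: ltW].
have /andP[l u] := truncn_itv x0.
exists (Num.truncn (t * 3 ^+ n)).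
  rewrite truncn_lt_nat // natrX -[ltRHS]mul1r ltr_pM2r //.
by rewrite ler_pdivrMr // l ler_pdivlMr // ltW.
Qed.

(** One box per triadic interval at the height of its left end, and a column of
boxes over each nonflat interval.  W is a bound for the oscillation of g at
scale 2^-n. *)
Lemma graph_cover (R : realType) (g : R -> R) (n : nat) (W : R) : 0 <= W ->
  (forall u v, 0 <= u <= 1 -> 0 <= v <= 1 -> `|u - v| <= (1 / 2) ^+ n ->
    `|g u - g v| <= W) ->
  let h : R := (1 / 3) ^+ n in
  exists L : seq (R * R),
    (size L)%:R <= 3 ^+ n + 2 ^+ n * (2 * W * 3 ^+ n + 1) /\
    forall p, graph (fun t => g (cantor_function t)) `[0, 1] p ->
      exists2 c, c \in L & c.1 <= p.1 <= c.1 + h /\ c.2 <= p.2 <= c.2 + h.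
Proof.
move=> W0 hW h.
have p0 : 0 < (3 : R) ^+ n by rewrite exprn_gt0.
have hE : h = (3 ^+ n)^-1 by rewrite /h div1r exprVn.
have h0 : 0 < h by rewrite hE invr_gt0.
have hS i : i.+1%:R / 3 ^+ n = i%:R / 3 ^+ n + h by rewrite -natr1 mulrDl mul1r hE.
pose V : R -> R := cantor_function.
pose y i := g (V (i%:R / 3 ^+ n)).
(* number of boxes of height h that cover an interval of length 2 * W *)
have [K KE] : exists K, K = (Num.truncn (2 * W * 3 ^+ n)).+1 by eexists.
have w0 : 0 <= 2 * W * 3 ^+ n by apply: mulr_ge0; [lra | exact: ltW].
pose nf := [seq i <- iota 0 (3 ^ n) | ~~ flat (R := R) n i].
exists ([seq (i%:R / 3 ^+ n, y i) | i <- iota 0 (3 ^ n)] ++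
  [seq (i%:R / 3 ^+ n, y i - W + l%:R * h) | i <- nf, l <- iota 0 K]).
split.
  rewrite size_cat size_map size_iota size_allpairs size_iota natrD natrX natrM.
  rewrite lerD2l; apply: ler_pM => //; first exact: size_not_flat.
  by rewrite KE -natr1 lerD2r truncn_le.
move=> p [t]; rewrite /= in_itv /= => t01 <- /=.
have [i hi /andP[l u]] := triadic_cell R n t t01.
have i0 : 0 <= i%:R / 3 ^+ n :> R by apply: divr_ge0 => //; exact: ltW.
have i1 : i.+1%:R / 3 ^+ n <= 1 :> R.
  by rewrite ler_pdivrMr // mul1r -natrX ler_nat.
have V1 : V (i%:R / 3 ^+ n) <= V t by apply: cantor_mono; lra.
have V2 : V t <= V (i.+1%:R / 3 ^+ n) by apply: cantor_mono; lra.
have [fi|fi] := boolP (flat (R := R) n i).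
  exists (i%:R / 3 ^+ n, y i).
    by rewrite mem_cat; apply/orP; left; apply/mapP; exists i => //; rewrite mem_iota.
  rewrite /= -hS l u; split => //.
  have -> : cantor_function t = V (i%:R / 3 ^+ n).
    by apply/eqP; rewrite eq_le V1 andbT; move/eqP: fi => fi; rewrite /V -fi.
  by rewrite /y; lra.
have hVt : `|g (V t) - y i| <= W.
  apply: hW; [apply: cantor_bounds; lra | apply: cantor_bounds; lra |].
  apply: cantor_dist; [lra | lra |].
  by rewrite -/h ger0_norm; [rewrite hS in u; lra | lra].
pose x := (g (V t) - y i + W) / h.
have x0 : 0 <= x.
  by apply: divr_ge0; [move: hVt; rewrite ler_norml; lra | exact: ltW].
have /andP[xl xu] := truncn_itv x0.
have xK : x <= 2 * W * 3 ^+ n.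
  rewrite /x hE invrK ler_pM2r //; move: hVt; rewrite ler_norml; lra.
exists (i%:R / 3 ^+ n, y i - W + (Num.truncn x)%:R * h).
  rewrite mem_cat; apply/orP; right.
  apply: (allpairs_f (fun i l : nat => (i%:R / 3 ^+ n, y i - W + l%:R * h))).
    by rewrite mem_filter fi mem_iota.
  by rewrite mem_iota /= add0n KE ltnS le_truncn.
rewrite /= -hS l u; split => //.
have e1 : x * h = g (V t) - y i + W by rewrite /x divfK // gt_eqF.
have a1 : (Num.truncn x)%:R * h <= x * h by rewrite ler_pM2r.
have a2 : x * h <= (Num.truncn x)%:R * h + h.
  by rewrite -[X in _ + X]mul1r -mulrDl natr1 ler_pM2r // ltW.
rewrite -/(V t); lra.
Qed.

(** The hypothesis 6 * q < 3^s is s > 1 + ln 2 / (2 * ln 3) when q^2 = 1/2. *)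
Lemma graph_hausdorff_measure0 (R : realType) (g : R -> R) (q C s : R) (n0 : nat) :
  0 < q -> q ^+ 2 = 1 / 2 -> 0 <= C ->
  (forall n u v, (n0 <= n)%N -> 0 <= u <= 1 -> 0 <= v <= 1 ->
    `|u - v| <= (1 / 2) ^+ n -> `|g u - g v| <= C * (n.+1%:R * q ^+ n)) ->
  0 < s -> 6 * q < 3 `^ s ->
  hausdorff_measure s (graph (fun t => g (cantor_function t)) `[0, 1]) = 0%E.
Proof.
move=> q0 qq C0 hg s0 hs; apply: hausdorff_measure_eq0 => delta e d0 e0.
set c := 3 `^ s in hs.
have c0 : 0 < c by rewrite powR_gt0.
have q12 : 1 / 2 < q by nra.
(* 2^n nonflat columns of q^n * 3^n boxes of size 3^-n: the total weight is
   of order n * (2 * q * 3 / c)^n *)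
pose rho := 6 * q / c.
have rho01 : 0 < rho < 1.
  apply/andP; split; first by apply: divr_gt0 => //; lra.
  by rewrite /rho ltr_pdivrMr // mul1r.
pose A := (2 : R) `^ s * (2 * C + 2).
have A0 : 0 < A by apply: mulr_gt0; [exact: powR_gt0 | lra].
have [N1 hN1] := mulrn_geometric_small R rho (e / A) rho01 (divr_gt0 e0 A0).
have [N2 hN2] := exprn_small R (1 / 3) (delta / 2) ltac:(lra) ltac:(lra).
pose n := maxn n0 (maxn N1 N2).
have n1 : (n0 <= n)%N by rewrite leq_maxl.
have n2 : (N1 <= n)%N by rewrite /n maxnCA leq_maxl.
have n3 : (N2 <= n)%N by rewrite /n maxnA leq_maxr.
pose W := C * (n.+1%:R * q ^+ n).
have qn0 : 0 < q ^+ n by rewrite exprn_gt0.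
have W0 : 0 <= W by apply: mulr_ge0 => //; apply: mulr_ge0 => //; exact: ltW.
have [L [sL hL]] := graph_cover R g n W W0 (fun u v => hg n u v n1).
have h0 : 0 <= (1 / 3 : R) ^+ n by apply: exprn_ge0; lra.
apply: le_trans (hausdorff_content_boxes R s delta _ _ L s0 h0 _ hL) _.
  by have := hN2 n n3; lra.
rewrite lee_fin.
have e1 : (2 * (1 / 3) ^+ n) `^ s = 2 `^ s * (c ^+ n)^-1.
  rewrite powRM ?h0 //.
  by congr (_ * _); rewrite div1r exprVn powR_expVn.
rewrite e1; apply: (@le_trans _ _ (A * (n.+1%:R * rho ^+ n))); last first.
  by have := hN1 n n2; rewrite ltr_pdivlMr // mulrC => /ltW.
have cn0 : 0 < (c ^+ n)^-1 by rewrite invr_gt0 exprn_gt0.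
have -> : rho ^+ n = (6 * q) ^+ n * (c ^+ n)^-1 by rewrite expr_div_n.
have -> : A * (n.+1%:R * ((6 * q) ^+ n * (c ^+ n)^-1)) =
  ((2 * C + 2) * (n.+1%:R * (6 * q) ^+ n)) * (2 `^ s * (c ^+ n)^-1).
  by rewrite /A; ring.
rewrite ler_pM2r; last by apply: mulr_gt0 => //; exact: powR_gt0.
apply: le_trans sL _.
have b1 : (3 : R) ^+ n <= (6 * q) ^+ n by rewrite lerXn2r ?nnegrE //; lra.
have b2 : (2 : R) ^+ n <= (6 * q) ^+ n by rewrite lerXn2r ?nnegrE //; lra.
have b3 : 2 ^+ n * (2 * W * 3 ^+ n) = 2 * C * (n.+1%:R * (6 * q) ^+ n).
  rewrite /W (_ : 6 = 2 * 3); last by ring.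
  by rewrite !exprMn; ring.
have b0 : 0 < (6 * q) ^+ n by apply: exprn_gt0; lra.
have b4 : (6 * q) ^+ n <= n.+1%:R * (6 * q) ^+ n.
  by apply: ler_peMl; [exact: ltW | rewrite ler1n].
rewrite mulrDr b3; lra.
Qed.

(** * Lower bound: energy of a sample of the graph *)

Definition close_at {R : realType} (n : nat) (p q : R * R) : bool :=
  (`|p.1 - q.1| <= (1 / 3) ^+ n) && (`|p.2 - q.2| <= (1 / 3) ^+ n).

(** A discrete Riesz energy: a pair at distance r receives the sum of b^n over the
levels n < N with 3^-n >= r, which is comparable to r^-gamma for b = 3^gamma. *)
Definition energy {R : realType} (b : R) (N L : nat) (p : nat -> R * R) : R :=
  (L%:R ^+ 2)^-1 * \sum_(n < N) \sum_(j < L) \sum_(k < L | k != j)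
     b ^+ n * (close_at n (p j) (p k))%:R.

(** If idx sorts the points into small clusters, Cauchy-Schwarz bounds the energy
below by the inverse of the total weight of the clusters.  The quadratic
inequality B * c^2 >= 2 * mu * c - mu^2 / B plays the role of Cauchy-Schwarz. *)
Lemma energy_partition (R : realType) (b M : R) (N L m : nat) (p : nat -> R * R)
    (idx : 'I_L -> 'I_m) (lev : 'I_m -> nat) :
  (0 < L)%N -> 1 <= b -> 0 <= M -> energy b N L p <= M ->
  (forall i, (lev i < N)%N /\ b ^+ lev i <= L%:R) ->
  (forall j k, idx j = idx k -> close_at (lev (idx j)) (p j) (p k)) ->
  (M + 1)^-1 <= \sum_i (b ^+ lev i)^-1.
Proof.
move=> L0 b1 M0 hM hlev hclose.
have b0 : 0 < b by lra.
have bp i : 0 < b ^+ lev i by rewrite exprn_gt0.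
have Lp : 0 < L%:R :> R by rewrite ltr0n.
pose c (i : 'I_m) : R := \sum_(j < L) (idx j == i)%:R.
pose F (j k : 'I_L) : R := b ^+ lev (idx j) * (idx j == idx k)%:R.
have E1 : \sum_(j < L) \sum_(k < L | k != j) F j k <= L%:R ^+ 2 * M.
  move: hM; rewrite /energy ler_pdivrMl ?exprn_gt0 //; apply: le_trans.
  rewrite exchange_big /=; apply: ler_sum => j _.
  rewrite exchange_big /=; apply: ler_sum => k kj.
  rewrite /F; case: eqVneq => [e|_]; last first.
    rewrite mulr0; apply: sumr_ge0 => n _; apply: mulr_ge0; rewrite ?ler0n //.
    by apply: exprn_ge0; exact: ltW.
  have [l1 l2] := hlev (idx j).
  rewrite (bigD1 (Ordinal l1)) //= (hclose _ _ e) lerDl.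
  apply: sumr_ge0 => n _; apply: mulr_ge0; rewrite ?ler0n //.
  by apply: exprn_ge0; exact: ltW.
(* The diagonal costs at most L ^+ 2, since each weight is at most L. *)
have E2 : \sum_(j < L) \sum_(k < L) F j k <= L%:R ^+ 2 * (M + 1).
  rewrite mulrDr mulr1; apply: le_trans (lerD E1 _); last first.
    exact: (lexx (L%:R ^+ 2)).
  rewrite (_ : \sum_(j < L) \sum_(k < L) F j k =
     \sum_(j < L) \sum_(k < L | k != j) F j k + \sum_(j < L) b ^+ lev (idx j)).
    rewrite lerD2l; apply: (@le_trans _ _ (\sum_(j < L) L%:R)).
      by apply: ler_sum => j _; have [] := hlev (idx j).
    by rewrite sumr_const card_ord expr2 [leRHS]mulr_natr.
  rewrite -big_split /=; apply: eq_bigr => j _.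
  by rewrite (bigD1 j) //= {1}/F eqxx mulr1 addrC.
have E3 : \sum_(j < L) \sum_(k < L) F j k = \sum_i b ^+ lev i * c i ^+ 2.
  transitivity (\sum_(j < L) b ^+ lev (idx j) * c (idx j)).
    apply: eq_bigr => j _; rewrite /F -mulr_sumr; congr (_ * _).
    by apply: eq_bigr => k _; rewrite eq_sym.
  rewrite (partition_big idx xpredT) //=; apply: eq_bigr => i _.
  rewrite expr2 mulrA {2}/c mulr_sumr big_mkcond /=; apply: eq_bigr => j _.
  by case: eqVneq => [->|_]; rewrite ?mulr1 ?mulr0.
have E4 : \sum_i c i = L%:R.
  rewrite /c exchange_big /= (eq_bigr (fun=> 1)); last first.
    move=> j _; rewrite (bigD1 (idx j)) //= eqxx big1 ?addr0 // => i.
    by rewrite eq_sym => /negbTE ->.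
  by rewrite sumr_const card_ord.
set S := \sum_i _.
(* the multiplier that makes the lower bound E5 optimal up to constants *)
pose mu := (M + 1) * L%:R.
have E5 : 2 * mu * L%:R - mu ^+ 2 * S <= \sum_i b ^+ lev i * c i ^+ 2.
  rewrite -E4 /S !mulr_sumr -sumrB; apply: ler_sum => i _.
  (* AM-GM in the form B * c^2 >= 2 * mu * c - mu^2 / B *)
  have h := sqr_ge0 (b ^+ lev i * c i - mu).
  rewrite -subr_ge0 -(pmulr_rge0 _ (bp i)).
  have -> : b ^+ lev i * (b ^+ lev i * c i ^+ 2 - (2 * mu * c i - mu ^+ 2 * (b ^+ lev i)^-1))
     = (b ^+ lev i * c i - mu) ^+ 2.
    by move: (bp i); move: (b ^+ lev i) => B B0; field; rewrite gt_eqF.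
  by [].
move: E5; rewrite -E3 => /le_trans /(_ E2).
have -> : 2 * mu * L%:R - mu ^+ 2 * S = L%:R ^+ 2 * (2 * (M + 1) - (M + 1) ^+ 2 * S).
  by rewrite /mu; ring.
rewrite ler_pM2l ?exprn_gt0 // => h.
have M1 : 0 < M + 1 by lra.
rewrite -div1r ler_pdivrMr // -(ler_pM2l M1); lra.
Qed.

(** Rounds the diameter of a covering set up to a power 3^-n, at the price of a
factor 3^gam and an error eps.  Rounding strictly up
leaves the margin eta needed to thicken the set. *)
Lemma level_of_weight (R : realType) (gam s eps : R) (U : set (R * R)) :
  0 < gam -> 0 <= s <= gam -> 0 < eps -> (ediam U <= (1 / 6)%:E)%E ->
  exists n eta, [/\ 0 < eta,
    (forall p q, U p -> U q -> enorm (p - q) + 2 * eta <= (1 / 3) ^+ n) &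
    (((3 `^ gam) ^+ n)^-1%:E <= (3 `^ gam)%:E * hausdorff_weight s U + eps%:E)%E].
Proof.
move=> gam0 /andP[s0 sg] e0 dU; set b := 3 `^ gam.
have b1 : 1 < b.
  have {1}-> : 1 = (1 : R) `^ gam by rewrite powR1.
  by apply: gt0_ltr_powR; rewrite ?nnegrE //; lra.
have bE n : (b ^+ n)^-1 = ((1 / 3) ^+ n) `^ gam.
  by rewrite div1r exprVn powR_expVn.
have w0 := hausdorff_weight_ge0 R s U.
have bw0 : (0 <= b%:E * hausdorff_weight s U)%E by rewrite mule_ge0 // lee_fin; lra.
(* When the diameter is 0 the error term eps pays for the level. *)
have tiny : exists n, (b ^+ n)^-1 <= eps.
  have [N hN] := exprn_small R b^-1 eps
    ltac:(by rewrite invr_ge0 invf_lt1; lra) e0.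
  by exists N; have := hN N (leqnn N); rewrite exprVn => /ltW.
have p3 n : 0 < (1 / 3 : R) ^+ n by apply: exprn_gt0; lra.
have [U0|/eqP/set0P U0] := pselect (U = set0).
  have [n hn] := tiny; exists n, 1; split=> //; first by rewrite U0.
  by apply: le_trans (leeDr _ bw0); rewrite lee_fin.
have d0 := ediam_ge0 _ _ U0.
have dfin : ediam U \is a fin_num.
  by rewrite ge0_fin_numE // (le_lt_trans dU) // ltry.
set dd := fine (ediam U).
have dE : ediam U = dd%:E by rewrite /dd fineK.
have dd0 : 0 <= dd by rewrite -lee_fin -dE.
have dd6 : dd <= 1 / 6 by rewrite -lee_fin -dE.
have hd p q : U p -> U q -> enorm (p - q) <= dd.
  by move=> Up Uq; rewrite -lee_fin -dE; exact: ediam_ge.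
have [dz|dnz] := eqVneq dd 0.
  have [n hn] := tiny; exists n, ((1 / 3) ^+ n / 2); split.
  - by rewrite divr_gt0.
  - by move=> p q Up Uq; have := hd p q Up Uq; rewrite dz; have := p3 n; lra.
  - by apply: le_trans (leeDr _ bw0); rewrite lee_fin.
have dp : 0 < dd by rewrite lt_neqAle eq_sym dnz.
have [n n1 n2] : exists2 n, dd < (1 / 3) ^+ n & (1 / 3) ^+ n.+1 <= dd.
  have ex : exists n, (1 / 3) ^+ n <= dd.
    have [N hN] := exprn_small R (1 / 3) dd ltac:(lra) dp.
    by exists N; exact/ltW/hN.
  case: (ex_minnP ex) => [[|k]] hk hmin.
    by move: hk; rewrite expr0; lra.
  by exists k => //; rewrite ltNge; apply/negP => /hmin; rewrite ltnn.
exists n, (((1 / 3) ^+ n - dd) / 2); split.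
- by apply: divr_gt0 => //; lra.
- by move=> p q Up Uq; have := hd p q Up Uq; lra.
apply: (@le_trans _ _ (b%:E * hausdorff_weight s U)%E); last first.
  by apply: leeDl; rewrite lee_fin ltW.
rewrite /hausdorff_weight; case: pselect => [h|h].
  by exfalso; move: U0 => [x]; rewrite h.
rewrite dE poweR_EFin -EFinM lee_fin.
have bn : (b ^+ n)^-1 = b * (b ^+ n.+1)^-1.
  rewrite exprS invfM mulrA divff ?mul1r //; lra.
rewrite bn ler_pM2l; last by lra.
rewrite bE; apply: (@le_trans _ _ (dd `^ gam)).
  by apply: ge0_ler_powR; rewrite ?nnegrE //; exact: ltW.
by apply: ger_powR => //; rewrite dp; lra.
Qed.

(** The form of compactness that lets the index of a covering set range over an
ordinal. *)
Lemma segment_cover_finite (R : realType) (O : nat -> set R) :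
  (forall i, open (O i)) -> (forall t, 0 <= t <= 1 -> exists i, O i t) ->
  exists m, forall t, 0 <= t <= 1 -> exists2 i, (i < m)%N & O i t.
Proof.
move=> oO cov; have := @segment_compact R 0 1; rewrite compact_cover.
move=> /(_ nat setT O (fun i _ => oO i)) [].
  by move=> t; rewrite /= in_itv /= => /cov [i Oi]; exists i.
move=> D _ hD; exists (\max_(i <- finmap.enum_fset D) i).+1 => t t01.
have [|i /= iD Oi] := hD t; first by rewrite /= in_itv.
by exists i => //; rewrite ltnS; apply: leq_bigmax_seq.
Qed.

Lemma bounded_levels (R : realType) (b : R) (lev : nat -> nat) (m : nat) : 0 < b ->
  exists N0, forall N i, (N0 <= N)%N -> (i < m)%N ->
    (lev i < N)%N /\ b ^+ lev i <= 2 ^+ N.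
Proof.
move=> b0; elim: m => [|m [N0 IH]]; first by exists 0%N.
have [N1 hN1] := exprn_small R (1 / 2) ((b ^+ lev m)^-1) ltac:(lra)
  ltac:(by rewrite invr_gt0 exprn_gt0).
exists (maxn N0 (maxn N1 (lev m).+1)) => N i.
rewrite !geq_max => /and3P[n0 n1 n2].
rewrite ltnS leq_eqVlt => /orP[/eqP ->|im]; last exact: IH.
split=> //; have := hN1 N n1.
by rewrite div1r exprVn ltf_pV2 ?posrE ?exprn_gt0 // => /ltW.
Qed.

(** A cover of small weight is thickened to an open one and reduced to a finite one
by compactness.  For N large, sorting the sample points by the sets of this
finite cover contradicts [energy_partition]. *)
Lemma graph_hausdorff_measure_neq0 (R : realType) (g : R -> R) (tp : nat -> nat -> R)
    (gam s M : R) :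
  (forall u e, 0 <= u <= 1 -> 0 < e -> exists2 d, 0 < d &
     forall v, 0 <= v <= 1 -> `|u - v| < d -> `|g u - g v| < e) ->
  (forall N j, (j < 2 ^ N)%N -> 0 <= tp N j <= 1) ->
  0 < gam -> 0 <= s <= gam -> 0 <= M ->
  (forall N0, exists2 N, (N0 <= N)%N &
     energy (3 `^ gam) N (2 ^ N) (fun j => (tp N j, g (cantor_function (tp N j)))) <= M) ->
  hausdorff_measure s (graph (fun t => g (cantor_function t)) `[0, 1]) != 0%E.
Proof.
move=> gc htp gam0 hs M0 hM; set G := graph _ _; set b := 3 `^ gam in hM.
have b1 : 1 < b.
  have {1}-> : 1 = (1 : R) `^ gam by rewrite powR1.
  by apply: gt0_ltr_powR; rewrite ?nnegrE //; lra.
apply/eqP => H0.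
(* b * e + e is half of (M + 1)^-1 *)
pose e := ((M + 1) * (2 * (b + 1)))^-1.
have e0 : 0 < e by rewrite invr_gt0; apply: mulr_gt0; lra.
have : (hausdorff_content s (1 / 6) G < e%:E)%E.
  apply: (@le_lt_trans _ _ 0%E); last by rewrite lte_fin.
  by rewrite -H0; apply: ereal_sup_ubound; exists (1 / 6) => //=; lra.
move=> /ereal_inf_lt [_ [U [GU dU] <-]] sumU.
(* Each covering set gets a level and a margin by which it can be thickened
   without leaving that level; thickening makes the cover open. *)
have /choice [le hle] : forall i, exists le : nat * R, [/\ 0 < le.2,
    (forall p q, U i p -> U i q -> enorm (p - q) + 2 * le.2 <= (1 / 3) ^+ le.1) &
    ((b ^+ le.1)^-1%:E <= b%:E * hausdorff_weight s (U i) + (e / 2 ^+ i.+1)%:E)%E].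
  move=> i; have [||n [eta h]] := level_of_weight R gam s (e / 2 ^+ i.+1) (U i) gam0 hs.
  - by apply: divr_gt0 => //; rewrite exprn_gt0.
  - exact: dU.
  by exists (n, eta).
pose lev i := (le i).1; pose eta i := (le i).2.
pose X t := g (cantor_function t).
pose nearU i t := exists2 p, U i p & `|t - p.1| < eta i /\ `|X t - p.2| < eta i.
(* O i is open by its very form, so continuity of X enters only in covO. *)
pose O i := [set t : R | exists2 r, 0 < r & forall t', 0 <= t' <= 1 -> `|t - t'| < r ->
   nearU i t'].
have oO i : open (O i).
  rewrite openE => t [r r0 hr]; apply/nbhs_ballP; exists (r / 2) => /=; first by lra.
  move=> t1; rewrite /ball /= => tt1; exists (r / 2); first by lra.
  move=> t2 t201 t12; apply: hr => //.
  have -> : t - t2 = (t - t1) + (t1 - t2) by ring.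
  by apply: le_lt_trans (ler_normD _ _) _; lra.
have covO t : 0 <= t <= 1 -> exists i, O i t.
  move=> t01; have [|i _ Ui] := GU (t, X t); first by exists t => //=; rewrite in_itv.
  have [eta0 _ _] := hle i; exists i.
  have [dl dl0 hdl] := gc _ _ (cantor_bounds R t t01) eta0.
  have [N hN] := exprn_small R (1 / 2) dl ltac:(lra) dl0.
  have p3 : 0 < (1 / 3 : R) ^+ N by apply: exprn_gt0; lra.
  exists (Num.min (eta i) ((1 / 3) ^+ N)); first by rewrite lt_min p3 andbT.
  move=> t' t'01; rewrite lt_min => /andP[a1 a2].
  exists (t, X t) => //=; split; first by rewrite distrC.
  rewrite distrC; apply: hdl; first exact: cantor_bounds.
  by apply: le_lt_trans (hN N (leqnn N)); apply: cantor_dist => //;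
    rewrite ltW // distrC.
have [m hm] := segment_cover_finite R O oO covO.
have bpos : 0 < b by lra.
have [N0 hN0] := bounded_levels R b lev m bpos.
have [N NN0 hE] := hM N0.
have idxP (j : 'I_(2 ^ N)) : exists i : 'I_m, nearU i (tp N j).
  have t01 := htp N j (ltn_ord j).
  have [i im [r r0 hr]] := hm _ t01.
  by exists (Ordinal im); apply: hr => //; rewrite subrr normr0.
have [idx hidx] := choice idxP.
have key : (M + 1)^-1 <= \sum_(i < m) (b ^+ lev i)^-1.
  apply: (energy_partition R b M N (2 ^ N) m _ idx) => //.
  - by rewrite expn_gt0.
  - exact: ltW.
  - exact: hE.
  - by move=> i; have := hN0 N i NN0 (ltn_ord i); rewrite natrX.
  - move=> j k jk; have [p Up [p1 p2]] := hidx j; have := hidx k; rewrite -jk => -[p' Up' [q1 q2]].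
    have [_ hd _] := hle (idx j).
    have := hd p p' Up Up'; have := enorm_ge1 R (p - p'); have := enorm_ge2 R (p - p').
    rewrite -/(eta (idx j)) -/(lev (idx j)) /close_at /=.
    move: p1 p2 q1 q2; rewrite -!/(X _).
    rewrite !ltr_norml !ler_norml => *.
    by apply/andP; split; lra.
have key2 : (((\sum_(i < m) (b ^+ lev i)^-1)%R)%:E <= b%:E * e%:E + e%:E)%E.
  rewrite -sumEFin.
  apply: (@le_trans _ _ (\sum_(i < m) (b%:E * hausdorff_weight s (U i) + (e / 2 ^+ i.+1)%:E))%E).
    by apply: lee_sum => i _; have [] := hle i.
  rewrite big_split /=; apply: leeD.
    rewrite -ge0_sume_distrr; last by move=> *; exact: hausdorff_weight_ge0.
    rewrite lee_pmul2l ?lte_fin //; apply: le_trans (ltW sumU).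
    rewrite -(big_mkord xpredT (fun i => hausdorff_weight s (U i))).
    by apply: nneseries_lim_ge => *; exact: hausdorff_weight_ge0.
  rewrite sumEFin lee_fin.
  suff -> : \sum_(i < m) (e / 2 ^+ i.+1) = e * (1 - (1 / 2) ^+ m).
    have h : 0 <= (1 / 2 : R) ^+ m by apply: exprn_ge0; lra.
    by rewrite ler_piMr ?ltW //; lra.
  elim: m {hm hN0 idx hidx idxP key} => [|k IH]; first by rewrite big_ord0 expr0 subrr mulr0.
  rewrite big_ord_recr /= IH !div1r !exprVn !exprS; field.
  by rewrite expf_neq0 // pnatr_eq0.
have : (M + 1)^-1 <= b * e + e.
  by apply: le_trans key _; rewrite -lee_fin EFinD EFinM.
have -> : b * e + e = (M + 1)^-1 / 2.
  rewrite /e; field; rewrite !gt_eqF //; lra.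
have := @invr_gt0 R (M + 1); lra.
Qed.

(** * Gaussian estimates *)

Lemma measurable_normr_ge (R : realType) (y : R) : measurable [set x : R | y <= `|x|].
Proof.
have -> : [set x : R | y <= `|x|] = `[y, +oo[ `|` `]-oo, -y].
  apply/seteqP; split => x /=; rewrite !in_itv /= andbT lerNr.
    by rewrite real_ler_normr ?num_real // => /orP.
  by move=> h; rewrite real_ler_normr ?num_real //; apply/orP.
by apply: measurableU; exact: measurable_itv.
Qed.

Lemma measurable_normr_le (R : realType) (y : R) : measurable [set x : R | `|x| <= y].
Proof.
have -> : [set x : R | `|x| <= y] = `[-y, y]%classic.
  by apply/seteqP; split => x /=; rewrite in_itv /= ler_norml.
exact: measurable_itv.
Qed.

Lemma normal_pdf0E (R : realType) (s x : R) : 0 < s ->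
  normal_pdf 0 s x = (s * Num.sqrt (2 * pi))^-1 * expR (- x ^+ 2 / (2 * s ^+ 2)).
Proof.
move=> s0; rewrite normal_pdfE ?gt_eqF // /normal_peak /normal_fun subr0.
have -> : s ^+ 2 * pi *+ 2 = s ^+ 2 * (2 * pi) by ring.
rewrite sqrtrM ?sqr_ge0 // sqrtr_sqr gtr0_norm //; congr (_ * expR (_ / _)); ring.
Qed.

(** On this set the density is at most 2 * exp (- 3 y^2 / (8 s^2)) times the density
with standard deviation 2 s, whose total mass is 1. *)
Lemma normal_prob_tail (R : realType) (s y : R) : 0 < s -> 0 <= y ->
  (normal_prob 0 s [set x | (y <= `|x|)%R] <= (2 * expR (- (3 / 8) * (y / s) ^+ 2))%:E)%E.
Proof.
move=> s0 y0; set A := [set x | _]; set c := 2 * _.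
have mA : measurable A := measurable_normr_ge R y.
have s2 : 0 < 2 * s by lra.
have c0 : 0 <= c by apply: mulr_ge0 => //; exact: expR_ge0.
apply: (@le_trans _ _ (c%:E * normal_prob 0 (2 * s) A)%E); last first.
  rewrite -[leRHS]mule1; apply: lee_pmul => //.
  by rewrite [leLHS](_ : _ = (normal_prob 0 (2 * s) : probability _ R) A) // probability_le1.
rewrite /normal_prob -ge0_integralZl //; last first.
- by move=> x _; rewrite lee_fin normal_pdf_ge0.
- by apply/measurable_EFinP; apply: measurable_funTS; exact: measurable_normal_pdf.
apply: ge0_le_integral => //.
- by move=> x _; rewrite lee_fin normal_pdf_ge0.
- by apply/measurable_EFinP; apply: measurable_funTS; exact: measurable_normal_pdf.
- apply/measurable_EFinP; apply: measurable_funM; first exact: measurable_cst.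
  by apply: measurable_funTS; exact: measurable_normal_pdf.
move=> x Ax; rewrite -EFinM lee_fin !normal_pdf0E //.
have r0 : 0 < Num.sqrt (2 * pi : R) by rewrite sqrtr_gt0 mulr_gt0 // pi_gt0.
have -> : c * ((2 * s * Num.sqrt (2 * pi))^-1 * expR (- x ^+ 2 / (2 * (2 * s) ^+ 2))) =
   (s * Num.sqrt (2 * pi))^-1 * expR (- (3 / 8) * (y / s) ^+ 2 - x ^+ 2 / (2 * (2 * s) ^+ 2)).
  by rewrite expRD mulNr /c; field; rewrite !gt_eqF.
rewrite ler_pM2l; last by rewrite invr_gt0 mulr_gt0.
rewrite ler_expR.
have yx : y ^+ 2 <= x ^+ 2 by rewrite -[x ^+ 2]real_normK ?num_real // ler_sqr ?nnegrE.
have -> : - (3 / 8) * (y / s) ^+ 2 - x ^+ 2 / (2 * (2 * s) ^+ 2) =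
   (- (3 / 8) * y ^+ 2 - x ^+ 2 / 8) / s ^+ 2 by field; rewrite gt_eqF.
have -> : - x ^+ 2 / (2 * s ^+ 2) = (- x ^+ 2 / 2) / s ^+ 2 by field; rewrite gt_eqF.
rewrite ler_pM2r ?invr_gt0 ?exprn_gt0 //; lra.
Qed.

(** The density is at most 1 / (2 s), because the square root of 2 pi is at least 2. *)
Lemma normal_prob_small_ball (R : realType) (s y : R) : 0 < s -> 0 <= y ->
  (normal_prob 0 s [set x | (`|x| <= y)%R] <= (y / s)%:E)%E.
Proof.
move=> s0 y0; set A := [set x | _].
have mA : measurable A := measurable_normr_le R y.
have AE : A = `[-y, y]%classic by apply/seteqP; split => x; rewrite /A /= in_itv /= ler_norml.
have r2 : 2 <= Num.sqrt (2 * pi : R).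
  rewrite -[leLHS]ger0_norm // -sqrtr_sqr ler_wsqrtr //.
  by have := pi_ge2 R; rewrite expr2; lra.
apply: (@le_trans _ _ (\int[lebesgue_measure]_(x in A) (2 * s)^-1%:E)%E).
  apply: ge0_le_integral => //.
  - by move=> x _; rewrite lee_fin normal_pdf_ge0.
  - by apply/measurable_EFinP; apply: measurable_funTS; exact: measurable_normal_pdf.
  move=> x _; rewrite lee_fin normal_pdf0E //.
  apply: (@le_trans _ _ ((s * Num.sqrt (2 * pi))^-1)).
    rewrite ler_piMr ?invr_ge0 ?mulr_ge0 ?sqrtr_ge0 ?(ltW s0) //.
    rewrite -expR0 ler_expR mulNr oppr_le0; apply: divr_ge0; rewrite ?sqr_ge0 //.
    by apply: mulr_ge0 => //; exact: sqr_ge0.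
  rewrite lef_pV2 ?posrE; [|by apply: mulr_gt0; lra..].
  by rewrite mulrC ler_pM2l.
have lA : (lebesgue_measure A = if (- y < y)%R then ((y - - y)%R)%:E else 0)%E.
  by rewrite AE (@lebesgue_measure_itv R `[-y, y]) /= lte_fin.
rewrite integral_cst // [X in (_ * X)%E](_ : _ = lebesgue_measure A) // lA.
case: ifPn => _; last by rewrite mule0 lee_fin divr_ge0 // ltW.
rewrite -EFinM lee_fin le_eqVlt; apply/orP; left; apply/eqP.
by field; rewrite gt_eqF.
Qed.

(** * From dyadic increments to a modulus of continuity *)

(** A point is reached from its dyadic approximation of level n by a chain of
dyadic increments whose bounds sum to a multiple of their first term.  The
constant 132 collects two chains and one step between neighbours. *)
Lemma dyadic_chaining (R : realType) (g : R -> R) (q : R) (n0 : nat) :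
  0 < q -> q ^+ 2 = 1 / 2 ->
  (forall u e, 0 <= u <= 1 -> 0 < e -> exists2 d, 0 < d &
     forall v, 0 <= v <= 1 -> `|u - v| < d -> `|g u - g v| < e) ->
  (forall m k, (n0 <= m)%N -> (k < 2 ^ m)%N ->
     `|g (k.+1%:R / 2 ^+ m) - g (k%:R / 2 ^+ m)| <= 4 * (m.+1%:R * q ^+ m)) ->
  forall n u v, (n0 <= n)%N -> 0 <= u <= 1 -> 0 <= v <= 1 ->
    `|u - v| <= (1 / 2) ^+ n -> `|g u - g v| <= 132 * (n.+1%:R * q ^+ n).
Proof.
move=> q0 qq gc hinc.
have q1 : q <= 71 / 100 by nra.
pose k n (u : R) := Num.truncn (u * 2 ^+ n).
pose D n u : R := (k n u)%:R / 2 ^+ n.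
have p2 n : 0 < (2 : R) ^+ n by rewrite exprn_gt0.
have kP n u : 0 <= u <= 1 -> (k n u)%:R <= u * 2 ^+ n < (k n u).+1%:R.
  by move=> hu; apply: truncn_itv; apply: mulr_ge0; [lra | exact: ltW].
have kle n u : 0 <= u <= 1 -> (k n u <= 2 ^ n)%N.
  move=> hu; rewrite -(ler_nat R) natrX; apply: le_trans (andP (kP n u hu)).1 _.
  by rewrite -[leRHS]mul1r ler_pM2r //; lra.
have Dle n u : 0 <= u <= 1 -> 0 <= D n u <= 1.
  move=> hu; apply/andP; split; first by apply: divr_ge0 => //; exact: ltW.
  rewrite /D ler_pdivrMr // mul1r -natrX ler_nat; exact: kle.
have Dnear n u : 0 <= u <= 1 -> `|u - D n u| <= (1 / 2) ^+ n.
  move=> hu; have /andP[h1 h2] := kP n u hu.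
  have a1 : D n u <= u by rewrite /D ler_pdivrMr.
  have a2 : u < D n u + (1 / 2) ^+ n.
    by rewrite /D div1r exprVn -[X in _ + X]mul1r -mulrDl natr1 ltr_pdivlMr.
  by rewrite ger0_norm; lra.
(* f is a discrete primitive: f m - f m.+1 dominates the increments of level
   m.+1, so that the chain of dyadic approximations telescopes. *)
pose f (m : nat) : R := 4 * ((4 * m%:R + 16) * q ^+ m).
have qn n : 0 < q ^+ n by rewrite exprn_gt0.
have f_ge0 n : 0 <= f n.
  by apply: mulr_ge0 => //; apply: mulr_ge0; [have := ler0n R n; lra | exact: ltW].
have fstep m : 4 * (m.+2%:R * q ^+ m.+1) <= f m - f m.+1.
  rewrite /f exprS -[m.+2%:R]natr1 -[m.+1%:R]natr1; have := ler0n R m; have := qn m.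
  move: (q ^+ m) (m%:R : R) => a x a0 x0.
  rewrite -subr_ge0.
  have -> : 4 * ((4 * x + 16) * a) - 4 * ((4 * (x + 1) + 16) * (q * a)) -
     4 * ((x + 1 + 1) * (q * a)) = 4 * a * ((4 * x + 16) - q * (5 * x + 22)) by ring.
  apply: mulr_ge0; first by lra.
  have : q * (5 * x + 22) <= 71 / 100 * (5 * x + 22) by apply: ler_wpM2r => //; lra.
  lra.
have step m u : (n0 <= m)%N -> 0 <= u <= 1 -> `|g (D m.+1 u) - g (D m u)| <= f m - f m.+1.
  move=> nm hu; apply: le_trans (fstep m).
  have /andP[h1 h2] := kP m u hu; have /andP[h3 h4] := kP m.+1 u hu.
  have D2 : D m u = (2 * k m u)%:R / 2 ^+ m.+1.
    by rewrite /D exprS natrM; field; rewrite gt_eqF.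
  have l1 : (2 * k m u <= k m.+1 u)%N.
    rewrite -ltnS -(ltr_nat R); apply: le_lt_trans h4.
    by rewrite natrM exprS mulrCA ler_pM2l.
  have l2 : (k m.+1 u < 2 * (k m u).+1)%N.
    rewrite -(ltr_nat R); apply: le_lt_trans h3 _.
    by rewrite natrM exprS mulrCA ltr_pM2l.
  have : k m.+1 u = (2 * k m u)%N \/ k m.+1 u = (2 * k m u).+1.
    move: l2; rewrite mulnS add2n ltnS leq_eqVlt => /orP[/eqP ->|]; first by right.
    by rewrite ltnS => l2; left; apply/eqP; rewrite eqn_leq l1 l2.
  case=> e.
    rewrite {1}/D e -D2 subrr normr0; apply: mulr_ge0 => //; apply: mulr_ge0 => //.
    exact: ltW.
  rewrite {1}/D e D2; apply: hinc; first exact: leqW.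
  by have := kle m.+1 u hu; rewrite e.
have chain n j u : (n0 <= n)%N -> 0 <= u <= 1 ->
    `|g (D (n + j)%N u) - g (D n u)| <= f n - f (n + j)%N.
  move=> nn hu; elim: j => [|j IH]; first by rewrite addn0 !subrr normr0.
  rewrite addnS.
  have -> : g (D (n + j).+1 u) - g (D n u) =
    (g (D (n + j).+1 u) - g (D (n + j)%N u)) + (g (D (n + j)%N u) - g (D n u)) by ring.
  apply: le_trans (ler_normD _ _) _.
  have := step (n + j)%N u (leq_trans nn (leq_addr j n)) hu; lra.
have base n u : (n0 <= n)%N -> 0 <= u <= 1 -> `|g u - g (D n u)| <= f n.
  move=> nn hu; apply/ler_addgt0Pr => e e0.
  have [dl dl0 hdl] := gc u e hu e0.
  have [N hN] := exprn_small R (1 / 2) dl ltac:(lra) dl0.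
  have -> : g u - g (D n u) = (g u - g (D (n + N)%N u)) + (g (D (n + N)%N u) - g (D n u)).
    by ring.
  apply: le_trans (ler_normD _ _) _.
  have := chain n N u nn hu; have := f_ge0 (n + N)%N.
  have : `|g u - g (D (n + N)%N u)| < e.
    apply: hdl; first exact: Dle.
    by apply: le_lt_trans (Dnear _ _ hu) _; apply: hN; exact: leq_addl.
  lra.
move=> n u v nn; wlog uv : u v / u <= v => [hw hu hv huv|hu hv huv].
  have [uv|/ltW vu] := leP u v; first exact: hw.
  by rewrite distrC; apply: hw => //; rewrite distrC.
have hD : `|g (D n u) - g (D n v)| <= 4 * (n.+1%:R * q ^+ n).
  have /andP[h1 h2] := kP n u hu; have /andP[h3 h4] := kP n v hv.
  have l1 : (k n u <= k n v)%N.
    rewrite -ltnS -(ltr_nat R); apply: le_lt_trans h4; apply: le_trans h1 _.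
    by rewrite ler_pM2r.
  have l2 : (k n v < (k n u).+2)%N.
    rewrite -(ltr_nat R); apply: le_lt_trans h3 _.
    have : v * 2 ^+ n <= u * 2 ^+ n + 1.
      have : (v - u) * 2 ^+ n <= 1.
        rewrite -ler_pdivlMr // div1r.
        by move: huv; rewrite distrC ger0_norm ?subr_ge0 // div1r exprVn.
      by rewrite mulrBl; lra.
    by move=> h; apply: le_lt_trans h _; rewrite -[ltRHS]natr1 ltrD2r.
  have : k n v = k n u \/ k n v = (k n u).+1.
    move: l2; rewrite ltnS leq_eqVlt => /orP[/eqP ->|]; first by right.
    by rewrite ltnS => l2; left; apply/eqP; rewrite eqn_leq l1 l2.
  case=> e.
    rewrite /D e subrr normr0; apply: mulr_ge0 => //; apply: mulr_ge0 => //.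
    exact: ltW.
  by rewrite distrC /D e; apply: hinc => //; have := kle n v hv; rewrite e.
have -> : g u - g v = (g u - g (D n u)) + (g (D n u) - g (D n v)) - (g v - g (D n v)).
  by ring.
apply: le_trans (ler_normB _ _) _.
have := ler_normD (g u - g (D n u)) (g (D n u) - g (D n v)).
have := base n u nn hu; have := base n v nn hv.
have : 8 * ((4 * n%:R + 16) * q ^+ n) + 4 * (n.+1%:R * q ^+ n) <= 132 * (n.+1%:R * q ^+ n).
  rewrite -[n.+1%:R]natr1; have := ler0n R n; have := qn n.
  move: (q ^+ n) (n%:R : R) => a x a0 x0.
  have : 0 <= x * a by apply: mulr_ge0 => //; exact: ltW.
  lra.
rewrite /f; lra.
Qed.

Section brownian_increments.
Context {d : measure_display} {T : measurableType d} {R : realType}.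
Variables (P : probability T R) (B : R -> {RV P >-> R}).
Hypothesis hB : brownian_motion P B.

Lemma measurable_increment (s t : R) (A : set R) : measurable A ->
  measurable [set w | A (B t w - B s w)].
Proof.
move=> mA; have h : measurable_fun setT (B t \- B s) by apply: measurable_funB.
by have := h measurableT A mA; rewrite setTI.
Qed.

Lemma increment_law (s t : R) (A : set R) : 0 <= s -> s < t -> measurable A ->
  P [set w | A (B t w - B s w)] = normal_prob 0 (Num.sqrt (t - s)) A.
Proof. by move=> s0 st mA; have [_ _ + _] := hB; apply. Qed.

Lemma increment_tail (s t y : R) : 0 <= s -> s < t -> 0 <= y ->
  (P [set w | (y <= `|B t w - B s w|)%R] <= (2 * expR (- (3 / 8) * (y ^+ 2 / (t - s))))%:E)%E.
Proof.
move=> s0 st y0; have st0 : 0 < t - s by lra.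
rewrite (increment_law s t [set x | y <= `|x|]) //; last exact: measurable_normr_ge.
apply: le_trans (normal_prob_tail _ _ _ _ y0) _; first by rewrite sqrtr_gt0.
by rewrite expr_div_n sqr_sqrtr // ltW.
Qed.

Lemma increment_small_ball (s t y : R) : 0 <= s -> 0 <= t -> s != t -> 0 <= y ->
  (P [set w | (`|B t w - B s w| <= y)%R] <= (y / Num.sqrt `|t - s|)%:E)%E.
Proof.
wlog st : s t / s < t => [hw s0 t0 st y0|s0 t0 _ y0].
  have [ts|ts|e] := ltgtP s t; last by rewrite e eqxx in st.
    exact: hw.
  have -> : [set w | `|B t w - B s w| <= y] = [set w | `|B s w - B t w| <= y].
    by apply/seteqP; split=> w /=; rewrite distrC.
  by rewrite distrC; apply: hw; rewrite // eq_sym.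
have st0 : 0 < t - s by lra.
rewrite (increment_law s t [set x | `|x| <= y]) //; last exact: measurable_normr_le.
by rewrite gtr0_norm //; apply: normal_prob_small_ball => //; rewrite sqrtr_gt0.
Qed.

End brownian_increments.

(** * Brownian increments are eventually small *)

Section brownian_paths.
Context {d : measure_display} {T : measurableType d} {R : realType}.
Variables (P : probability T R) (B : R -> {RV P >-> R}).
Hypothesis hB : brownian_motion P B.

Definition large_increment (m k : nat) : set T :=
  [set w | 4 * (m.+1%:R * Num.sqrt (1 / 2) ^+ m) <=
             `|B (k.+1%:R / 2 ^+ m) w - B (k%:R / 2 ^+ m) w|].

Lemma measurable_large_increment m k : measurable (large_increment m k).
Proof.
by apply: (measurable_increment P B _ _ [set x | _ <= `|x|]); exact: measurable_normr_ge.
Qed.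

(** The threshold is 4 (m + 1) standard deviations, so the tail beats the number 2^m
of increments of level m by a geometric factor. *)
Lemma large_increment_prob m k :
  (P (large_increment m k) <= (2 * (1 / 4) ^+ m.+1)%:E)%E.
Proof.
set q := Num.sqrt (1 / 2 : R).
have qq : q ^+ 2 = 1 / 2 by rewrite sqr_sqrtr //; lra.
have q0 : 0 < q by rewrite sqrtr_gt0; lra.
have p2 : 0 < (2 : R) ^+ m by rewrite exprn_gt0.
have kk : k.+1%:R / 2 ^+ m - k%:R / 2 ^+ m = (2 ^+ m)^-1 :> R.
  by rewrite -mulrBl -[k.+1%:R]natr1 addrAC subrr add0r mul1r.
have y0 : 0 <= 4 * (m.+1%:R * q ^+ m).
  by rewrite !mulr_ge0 // exprn_ge0 // ltW.
apply: le_trans (increment_tail P B hB _ _ _ _ _ y0) _.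
- by apply: divr_ge0 => //; exact: ltW.
- by rewrite -subr_gt0 kk invr_gt0.
rewrite lee_fin ler_pM2l // kk invrK.
have -> : (4 * (m.+1%:R * q ^+ m)) ^+ 2 * 2 ^+ m = 16 * m.+1%:R ^+ 2.
  have -> : (4 * (m.+1%:R * q ^+ m)) ^+ 2 * 2 ^+ m =
      16 * m.+1%:R ^+ 2 * ((q ^+ 2) ^+ m * 2 ^+ m).
    by rewrite -exprM mulnC exprM; ring.
  by rewrite qq -exprMn (_ : 1 / 2 * 2 = 1) ?expr1n ?mulr1 //; lra.
have x1 : 1 <= m.+1%:R :> R by rewrite ler1n.
apply: (@le_trans _ _ (expR (m.+1%:R * - 6))).
  rewrite ler_expR; nra.
rewrite expRM_natl lerXn2r ?nnegrE ?expR_ge0 //; try lra.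
rewrite expRN div1r lef_pV2 ?posrE ?expR_gt0 //.
by apply: le_trans (expR_ge1Dx _); lra.
Qed.

Lemma ae_eventually_small_increments : {ae P, forall w, exists n0, forall m k,
  (n0 <= m)%N -> (k < 2 ^ m)%N ->
  `|B (k.+1%:R / 2 ^+ m) w - B (k%:R / 2 ^+ m) w| <=
     4 * (m.+1%:R * Num.sqrt (1 / 2) ^+ m)}.
Proof.
pose A m := \big[setU/set0]_(k < 2 ^ m) large_increment m k.
have mA m : measurable (A m).
  by apply: bigsetU_measurable => k _; exact: measurable_large_increment.
have PA m : (P (A m) <= (1 / (2 ^ m.+1)%:R)%:E)%E.
  have sub := @content_subadditive _ _ _ P (A m) (large_increment m) (2 ^ m)%N
    (fun k _ => measurable_large_increment m k) (mA m) (@subset_refl _ _).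
  apply: le_trans sub _.
  apply: (@le_trans _ _ (\sum_(k < 2 ^ m) (2 * (1 / 4) ^+ m.+1 : R)%:E)%E).
    by apply: lee_sum => k _; exact: large_increment_prob.
  rewrite sumEFin sumr_const card_ord lee_fin -[leLHS]mulr_natl !natrX.
  rewrite mulrA -exprSr !div1r exprVn (_ : 4 = 2 * 2) ?exprMn; last by ring.
  by rewrite invfM mulrA divff ?mul1r // expf_neq0 // pnatr_eq0.
(* Borel-Cantelli *)
have null : P (lim_sup_set A) = 0%E.
  apply: lim_sup_set_cvg0 => //.
  apply: (@le_lt_trans _ _ (\sum_(0 <= n <oo) (1 / (2 ^ n.+1)%:R : R)%:E)%E).
    by apply: lee_nneseries => *; [exact: measure_ge0 | exact: PA].
  by apply: le_lt_trans (epsilon_trick0 xpredT ler01) _; rewrite ltry.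
exists (lim_sup_set A); split => //.
  by apply: bigcap_measurable => // n _; apply: bigcup_measurable.
move=> w /= nw n _; apply: contrapT => nA; apply: nw; exists n => m k nm km.
rewrite leNgt; apply/negP => h; apply: nA; exists m => //.
rewrite /A -(bigcup_mkord (2 ^ m) (large_increment m)).
by exists k => //; exact: ltW.
Qed.

End brownian_paths.

(** * Expected energy *)

Lemma bounded_measurable_sum {d} {T : measurableType d} {R : realType}
    (I : Type) (r : seq I) (Q : pred I) (F : I -> T -> R) :
  (forall i, Q i -> bounded_measurable (F i)) ->
  bounded_measurable (fun x => \sum_(i <- r | Q i) F i x).
Proof.
move=> bF; elim: r => [|i r IH].
  by under eq_fun do rewrite big_nil; exact: bounded_measurable_cst.
under eq_fun do rewrite big_cons.
by case: (boolP (Q i)) => // Qi; apply: bounded_measurableD => //; exact: bF.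
Qed.

Lemma Rint_sum {d} {T : measurableType d} {R : realType}
    (mu : {finite_measure set T -> \bar R})
    (I : Type) (r : seq I) (Q : pred I) (F : I -> T -> R) :
  (forall i, Q i -> bounded_measurable (F i)) ->
  \int[mu]_x (\sum_(i <- r | Q i) F i x) = \sum_(i <- r | Q i) \int[mu]_x F i x.
Proof.
move=> bF; elim: r => [|i r IH].
  rewrite big_nil; under eq_Rintegral do rewrite big_nil.
  by rewrite Rintegral_cst // mul0r.
rewrite big_cons; under eq_Rintegral do rewrite big_cons.
case: (boolP (Q i)) => // Qi; rewrite RintD ?IH //; first exact: bF.
exact: bounded_measurable_sum.
Qed.

(** Compares with the increments of the square root, 1 / sqrt (i + 1) being at most
2 (sqrt (i + 1) - sqrt i). *)
Lemma sum_inv_sqrt (R : realType) (M : nat) :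
  \sum_(0 <= i < M) (Num.sqrt i.+1%:R)^-1 <= 2 * Num.sqrt M%:R :> R.
Proof.
elim: M => [|M IH]; first by rewrite big_nil sqrtr0 mulr0.
rewrite big_nat_recr //=; apply: le_trans (lerD IH (lexx _)) _.
set a := Num.sqrt M%:R; set b := Num.sqrt M.+1%:R.
have b0 : 0 < b :> R by rewrite sqrtr_gt0.
have a0 : 0 <= a :> R by exact: sqrtr_ge0.
have aa : a ^+ 2 = M%:R :> R by rewrite sqr_sqrtr.
have bb : b ^+ 2 = M%:R + 1 :> R by rewrite sqr_sqrtr // natr1.
have h : 2 * (b - a) * b >= 1 by nra.
have : b^-1 <= 2 * (b - a) by rewrite -div1r ler_pdivrMr.
lra.
Qed.

(** The kernel 1 / sqrt l cut off at distance m.  It vanishes at 0, so that sums may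
run over the diagonal. *)
Definition trunc_kernel {R : realType} (m l : nat) : R :=
  if (0 < l <= m)%N then (Num.sqrt l%:R)^-1 else 0.

Lemma trunc_kernel_ge0 (R : realType) (m l : nat) : 0 <= trunc_kernel m l :> R.
Proof. by rewrite /trunc_kernel; case: ifP => // _; rewrite invr_ge0 sqrtr_ge0. Qed.

Lemma sum_trunc_kernel (R : realType) (m M : nat) :
  \sum_(0 <= i < M) trunc_kernel m i.+1 <= 2 * Num.sqrt m%:R :> R.
Proof.
have claim K : (K <= m)%N -> \sum_(0 <= i < K) trunc_kernel m i.+1 <= 2 * Num.sqrt m%:R :> R.
  move=> Km; apply: (@le_trans _ _ (\sum_(0 <= i < K) (Num.sqrt i.+1%:R)^-1)).
    apply: ler_sum => i _; rewrite /trunc_kernel; case: ifP => _; first exact: lexx.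
    by rewrite invr_ge0 sqrtr_ge0.
  apply: le_trans (sum_inv_sqrt R K) _; rewrite ler_pM2l //.
  by rewrite ler_sqrt // ler_nat.
have [Mm|/ltnW mM] := leqP M m; first exact: claim.
rewrite (big_cat_nat (n := m)) //= [X in _ + X]big_nat_cond [X in _ + X]big1 ?addr0.
  exact: claim.
by move=> i /andP[/andP[mi _] _]; rewrite /trunc_kernel [(i < m)%N]ltnNge mi andbF.
Qed.

Lemma sum_trunc_kernel_dist (R : realType) (m L j : nat) : (j < L)%N ->
  \sum_(k < L) trunc_kernel m (k - j + (j - k))%N <= 4 * Num.sqrt m%:R :> R.
Proof.
move=> jL; rewrite -(big_mkord xpredT (fun k => trunc_kernel m (k - j + (j - k))%N)).
rewrite (big_cat_nat (n := j)) //=; last exact: ltnW.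
rewrite (big_ltn jL) /= subnn addn0 {1}/trunc_kernel /= add0r.
have h1 : \sum_(0 <= k < j) trunc_kernel m (k - j + (j - k))%N <= 2 * Num.sqrt m%:R :> R.
  rewrite big_nat_rev /= add0n (eq_big_nat _ _ (F2 := fun i => trunc_kernel m i.+1)).
    exact: sum_trunc_kernel.
  move=> i /andP[_ ij]; congr trunc_kernel.
  rewrite subKn //; have -> : (j - i.+1 - j = 0)%N by apply/eqP; rewrite subn_eq0 leq_subr.
  by [].
have h2 : \sum_(j.+1 <= k < L) trunc_kernel m (k - j + (j - k))%N <= 2 * Num.sqrt m%:R :> R.
  rewrite -{1}[j.+1]add0n big_addn (eq_big_nat _ _ (F2 := fun i => trunc_kernel m i.+1)).
    exact: sum_trunc_kernel.
  move=> i _; congr trunc_kernel; rewrite addnS subSn ?leq_addl // addnK.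
  have -> : (j - (i + j).+1 = 0)%N by apply/eqP; rewrite subn_eq0 -addSn leq_addl.
  by rewrite addn0.
lra.
Qed.

Lemma geometric_sum_le (R : realType) (r : R) (N : nat) : 0 <= r < 1 ->
  \sum_(n < N) r ^+ n <= (1 - r)^-1.
Proof.
move=> /andP[r0 r1]; have p : 0 < 1 - r by lra.
rewrite -(ler_pM2r p) mulVf ?gt_eqF // mulrC.
have -> : (1 - r) * \sum_(n < N) r ^+ n = 1 - r ^+ N.
  by rewrite -opprB -[RHS]opprB mulNr -subrX1.
by have := exprn_ge0 N r0; lra.
Qed.

Lemma natr_dist (R : realType) (j k : nat) :
  `|k%:R - j%:R| = (k - j + (j - k))%:R :> R.
Proof.
have [jk|kj] := leqP j k.
  have -> : (j - k = 0)%N by apply/eqP.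
  by rewrite addn0 natrB // ger0_norm // subr_ge0 ler_nat.
have -> : (k - j = 0)%N by apply/eqP; rewrite subn_eq0 ltnW.
by rewrite add0n natrB ?(ltnW kj) // distrC ger0_norm // subr_ge0 ler_nat ltnW.
Qed.

Section expected_energy.
Context {d : measure_display} {T : measurableType d} {R : realType}.
Variables (P : probability T R) (B : R -> {RV P >-> R}).
Hypothesis hB : brownian_motion P B.
Variable tp : nat -> nat -> R.
Hypothesis tp01 : forall N j, (j < 2 ^ N)%N -> 0 <= tp N j <= 1.
Hypothesis tpV : forall N j, (j < 2 ^ N)%N -> cantor_function (tp N j) = j%:R / 2 ^+ N.
Variable b : R.
Let q : R := Num.sqrt (1 / 2).
Hypothesis b0 : 0 < b.
Hypothesis bq : b * q / 3 < 1.

Definition graph_point (N : nat) (w : T) (j : nat) : R * R :=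
  (tp N j, B (cantor_function (tp N j)) w).

Definition close_event (N n j k : nat) : set T :=
  [set w | close_at n (graph_point N w j) (graph_point N w k)].

Lemma measurable_close_event N n j k : measurable (close_event N n j k).
Proof.
rewrite /close_event /close_at /=.
have [h|h] := boolP (`|tp N j - tp N k| <= (1 / 3) ^+ n); last first.
  rewrite (_ : [set w | _] = set0) //; apply/seteqP; split => w //=.
rewrite (_ : [set w | _] = [set w | `|B (cantor_function (tp N j)) w -
    B (cantor_function (tp N k)) w| <= (1 / 3) ^+ n]) //.
by apply: (measurable_increment P B _ _ [set x | `|x| <= _]); exact: measurable_normr_le.
Qed.

(** If the abscissas are 3^-n close, the modulus of continuity of the Cantor function
puts the parameters within 2^(N - n) dyadic steps; then the small ball estimate
applies to one Brownian increment. *)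
Lemma close_event_prob N n j k : (n < N)%N -> (j < 2 ^ N)%N -> (k < 2 ^ N)%N -> k != j ->
  fine (P (close_event N n j k)) <=
    (1 / 3) ^+ n * Num.sqrt (2 ^+ N) * trunc_kernel (2 ^ (N - n)) (k - j + (j - k)).
Proof.
move=> nN jN kN kj.
have p2 : 0 < (2 : R) ^+ N by rewrite exprn_gt0.
have p3 : 0 <= (1 / 3 : R) ^+ n by apply: exprn_ge0; lra.
have rhs0 : 0 <= (1 / 3) ^+ n * Num.sqrt (2 ^+ N) *
    trunc_kernel (2 ^ (N - n)) (k - j + (j - k)) :> R.
  by apply: mulr_ge0; [apply: mulr_ge0 => //; exact: sqrtr_ge0 | exact: trunc_kernel_ge0].
have [h|h] := boolP (`|tp N j - tp N k| <= (1 / 3) ^+ n); last first.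
  rewrite (_ : close_event N n j k = set0) ?measure0 //.
  by apply/seteqP; split => w //; rewrite /close_event /close_at /= (negbTE h).
have dE : `|cantor_function (tp N j) - cantor_function (tp N k)| =
    (k - j + (j - k))%:R / 2 ^+ N.
  by rewrite !tpV // -mulrBl normrM distrC natr_dist [X in _ * X]gtr0_norm ?invr_gt0.
have d1 : (0 < k - j + (j - k))%N by rewrite addn_gt0 !subn_gt0 orbC -neq_ltn.
have d2 : (k - j + (j - k) <= 2 ^ (N - n))%N.
  rewrite -(ler_nat R) natrX.
  have := cantor_dist R n _ _ (tp01 _ _ kN) (tp01 _ _ jN) h.
  rewrite dE ler_pdivrMr // => hd; apply: le_trans hd _.
  rewrite -{1}(subnK (ltnW nN)) exprD mulrCA -exprMn.
  by rewrite (_ : 1 / 2 * 2 = 1) ?expr1n ?mulr1 //; lra.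
rewrite /trunc_kernel d1 d2 /=.
have mC := measurable_close_event N n j k.
rewrite -lee_fin fineK ?fin_num_measure //.
pose s := cantor_function (tp N k); pose t := cantor_function (tp N j).
apply: (@le_trans _ _ (P [set w | `|B t w - B s w| <= (1 / 3) ^+ n])).
  apply: le_measure; rewrite ?inE //.
    by apply: (measurable_increment P B _ _ [set x | `|x| <= _]); exact: measurable_normr_le.
  by move=> w; rewrite /close_event /close_at /= => /andP[].
have st : s != t.
  rewrite /s /t !tpV //; apply/eqP => /(mulIf (_ : (2 ^+ N)^-1 != 0)) => /(_ ltac:(by rewrite invr_eq0 gt_eqF)).
  by move/eqP; rewrite eqr_nat (negbTE kj).
have s0 : 0 <= s by have := cantor_bounds R _ (tp01 _ _ kN); rewrite -/s; lra.
have t0 : 0 <= t by have := cantor_bounds R _ (tp01 _ _ jN); rewrite -/t; lra.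
apply: le_trans (increment_small_ball P B hB s t _ s0 t0 st p3) _.
rewrite lee_fin /t /s dE sqrtrM ?ler0n // sqrtrV ?(ltW p2) // invfM invrK.
by rewrite mulrA mulrAC.
Qed.

Definition graph_energy (N : nat) (w : T) : R := energy b N (2 ^ N) (graph_point N w).

Lemma graph_energyE N w : graph_energy N w = ((2 ^ N)%:R ^+ 2)^-1 *
  \sum_(n < N) \sum_(j < 2 ^ N) \sum_(k < 2 ^ N | k != j)
     b ^+ n * \1_(close_event N n j k) w.
Proof.
rewrite /graph_energy /energy; congr (_ * _).
apply: eq_bigr => n _; apply: eq_bigr => j _; apply: eq_bigr => k _.
by rewrite indicE /close_event mem_setE.
Qed.

Lemma graph_energy_ge0 N w : 0 <= graph_energy N w.
Proof.
rewrite /graph_energy /energy; apply: mulr_ge0; first by rewrite invr_ge0 exprn_ge0.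
do 3 (apply: sumr_ge0 => ? _).
by apply: mulr_ge0; [apply: exprn_ge0; exact: ltW | exact: ler0n].
Qed.

Let bm_term N n j k : bounded_measurable (fun w => b ^+ n * \1_(close_event N n j k) w).
Proof.
apply: bounded_measurableM; first exact: bounded_measurable_cst.
by apply: bounded_measurable_indic; exact: measurable_close_event.
Qed.

Lemma bounded_measurable_graph_energy N : bounded_measurable (graph_energy N).
Proof.
rewrite (_ : graph_energy N = fun w => ((2 ^ N)%:R ^+ 2)^-1 *
  \sum_(n < N) \sum_(j < 2 ^ N) \sum_(k < 2 ^ N | k != j)
     b ^+ n * \1_(close_event N n j k) w); last by apply/funext => w; exact: graph_energyE.
apply: bounded_measurableM; first exact: bounded_measurable_cst.
apply: bounded_measurable_sum => n _; apply: bounded_measurable_sum => j _.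
by apply: bounded_measurable_sum => k _; exact: bm_term.
Qed.

(** Summing [close_event_prob] over k gives b^n * 3^-n * q^n for level n, up to
constants, a geometric series of ratio b * q / 3. *)
Lemma expected_graph_energy N : \int[P]_w graph_energy N w <= 4 * (1 - b * q / 3)^-1.
Proof.
have q0 : 0 < q by rewrite sqrtr_gt0; lra.
have qq : q ^+ 2 = 1 / 2 by rewrite sqr_sqrtr //; lra.
have p2 : 0 < (2 : R) ^+ N by rewrite exprn_gt0.
under eq_Rintegral do rewrite graph_energyE.
have b3 n j : bounded_measurable (fun w =>
    \sum_(k < 2 ^ N | k != j :> 'I_(2 ^ N)) b ^+ n * \1_(close_event N n j k) w).
  by apply: bounded_measurable_sum => k _; exact: bm_term.
have b2 n : bounded_measurable (fun w => \sum_(j < 2 ^ N)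
    \sum_(k < 2 ^ N | k != j :> 'I_(2 ^ N)) b ^+ n * \1_(close_event N n j k) w).
  by apply: bounded_measurable_sum => j _.
rewrite RintZ; last by apply: bounded_measurable_sum => n _.
rewrite Rint_sum //.
have bound (n : 'I_N) : \int[P]_w (\sum_(j < 2 ^ N)
    \sum_(k < 2 ^ N | k != j) b ^+ n * \1_(close_event N n j k) w) <=
    (2 ^+ N) ^+ 2 * (4 * (b * q / 3) ^+ n).
  rewrite Rint_sum //.
  apply: (@le_trans _ _ (\sum_(j < 2 ^ N) 2 ^+ N * (4 * (b * q / 3) ^+ n))); last first.
    by rewrite sumr_const card_ord -[leLHS]mulr_natl natrX mulrA -expr2.
  apply: ler_sum => j _; rewrite Rint_sum //.
  apply: (@le_trans _ _ (\sum_(k < 2 ^ N) b ^+ n * ((1 / 3) ^+ n * Num.sqrt (2 ^+ N)) *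
      trunc_kernel (2 ^ (N - n)) (k - j + (j - k))%N)).
    rewrite big_mkcond /=; apply: ler_sum => k _.
    have bn0 : 0 <= b ^+ n by apply: exprn_ge0; exact: ltW.
    case: ifP => kj.
      rewrite RintZ; last by apply: bounded_measurable_indic; exact: measurable_close_event.
      rewrite Rint_indic; last exact: measurable_close_event.
      by rewrite -mulrA; apply: ler_wpM2l => //; exact: close_event_prob.
    apply: mulr_ge0; last exact: trunc_kernel_ge0.
    by rewrite !mulr_ge0 ?sqrtr_ge0 ?exprn_ge0 //; exact: ltW.
  rewrite -mulr_sumr.
  apply: (@le_trans _ _ (b ^+ n * ((1 / 3) ^+ n * Num.sqrt (2 ^+ N)) *
      (4 * Num.sqrt (2 ^ (N - n))%:R))).
    apply: ler_wpM2l; last exact: sum_trunc_kernel_dist.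
    by rewrite !mulr_ge0 ?sqrtr_ge0 ?exprn_ge0 //; exact: ltW.
  have e1 : Num.sqrt (2 ^+ N) * Num.sqrt (2 ^ (N - n))%:R = 2 ^+ N * q ^+ n.
    rewrite -sqrtrM ?(ltW p2) // natrX.
    have -> : 2 ^+ N * 2 ^+ (N - n) = (2 ^+ N * q ^+ n) ^+ 2.
      rewrite exprMn [(q ^+ n) ^+ 2]exprAC qq expr2 -mulrA; congr (_ * _).
      have -> : 2 ^+ N = 2 ^+ (N - n) * 2 ^+ n :> R.
        by rewrite -exprD subnK // ltnW.
      rewrite -mulrA -exprMn.
      by rewrite (_ : 2 * (1 / 2) = 1) ?expr1n ?mulr1 //; lra.
    by rewrite sqrtr_sqr ger0_norm // mulr_ge0 // exprn_ge0 // ltW.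
  have -> : b ^+ n * ((1 / 3) ^+ n * Num.sqrt (2 ^+ N)) * (4 * Num.sqrt (2 ^ (N - n))%:R) =
    4 * b ^+ n * (1 / 3) ^+ n * (Num.sqrt (2 ^+ N) * Num.sqrt (2 ^ (N - n))%:R) by ring.
  rewrite e1 (_ : b * q / 3 = b * (1 / 3) * q) ?exprMn; last by ring.
  by rewrite le_eqVlt; apply/orP; left; apply/eqP; ring.
apply: (@le_trans _ _ (((2 ^ N)%:R ^+ 2)^-1 * \sum_(n < N) (2 ^+ N) ^+ 2 * (4 * (b * q / 3) ^+ n))).
  by apply: ler_wpM2l; [rewrite invr_ge0 exprn_ge0 | apply: ler_sum => n _].
rewrite natrX -mulr_sumr mulrA mulVf ?mul1r; last by rewrite gt_eqF // exprn_gt0.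
rewrite -mulr_sumr ler_pM2l //; apply: geometric_sum_le; rewrite bq andbT.
by rewrite !mulr_ge0 ?invr_ge0 // ltW.
Qed.

(** By Fatou's lemma the lower limit of the energies is integrable, hence finite
almost surely. *)
Lemma ae_energy_bounded_often : {ae P, forall w, exists M : R, 0 <= M /\
  forall N0, exists2 N, (N0 <= N)%N & graph_energy N w <= M}.
Proof.
pose C : R := 4 * (1 - b * q / 3)^-1.
pose f N w := (graph_energy N w)%:E.
have mf N : measurable_fun setT (f N).
  by apply/measurable_EFinP; have [] := bounded_measurable_graph_energy N.
have f0 N w : (0 <= f N w)%E by rewrite lee_fin graph_energy_ge0.
have intf N : (\int[P]_w f N w <= C%:E)%E.
  have fi : (\int[P]_w f N w)%E \is a fin_num.
    exact: integrable_fin_num (bounded_measurable_integrable P _ (bounded_measurable_graph_energy N)).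
  by rewrite -(fineK fi) lee_fin; exact: expected_graph_energy.
have einfE u : limn_einf u = ereal_sup (range (einfs u)) :> \bar R.
  by rewrite limn_einf_lim; apply/cvg_lim => //; exact: cvg_einfs_sup.
pose h w := limn_einf (f ^~ w).
have mh : measurable_fun setT h.
  apply: measurableT_comp => //; apply: measurable_fun_limn_esup => N.
  exact: measurableT_comp.
have h0 w : (0 <= h w)%E.
  rewrite /h einfE; apply: le_ereal_sup_tmp; exists (einfs (f ^~ w) 0%N); first by exists 0%N.
  by apply: le_ereal_inf_tmp => _ [N _ <-].
have inth : (\int[P]_w h w < +oo)%E.
  apply: (@le_lt_trans _ _ C%:E); last by rewrite ltry.
  apply: le_trans (fatou P measurableT mf (fun n x _ => f0 n x)) _.
  rewrite einfE; apply: ge_ereal_sup => _ [n _ <-].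
  apply: le_trans (intf n); apply: ereal_inf_lbound; exists n => //=.
have ih : P.-integrable setT h.
  apply/integrableP; split => //.
  by under eq_integral do rewrite gee0_abs //.
apply: filterS (integrable_ae measurableT ih) => w /(_ I).
rewrite ge0_fin_numE // => hw.
have [M hM] : exists M : R, (h w < M%:E)%E.
  exists (fine (h w) + 1).
  by rewrite -[X in (X < _)%E](@fineK _ (h w)) ?ge0_fin_numE // lte_fin ltrDl.
(* a finite lower limit leaves infinitely many N below any larger bound *)
exists `|M|; split => // N0.
have : (einfs (f ^~ w) N0 < M%:E)%E.
  apply: le_lt_trans hM; rewrite /h einfE.
  by apply: ereal_sup_ubound; exists N0.
move=> /ereal_inf_lt [_ [N /= NN0 <-]]; rewrite lte_fin => hN.
by exists N => //; apply: le_trans (ltW hN) (ler_norm _).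
Qed.

End expected_energy.

(** * The theorem *)

Lemma within_continuous_eps (R : realType) (g : R -> R) :
  {within `[0, +oo[, continuous g} ->
  forall u e, 0 <= u <= 1 -> 0 < e -> exists2 d, 0 < d &
     forall v, 0 <= v <= 1 -> `|u - v| < d -> `|g u - g v| < e.
Proof.
move=> /subspace_continuousP gc u e hu e0.
have u0 : `[0, +oo[%classic u by rewrite /= in_itv /= andbT; lra.
have /cvgrPdist_lt/(_ e e0) := gc u u0.
rewrite /prop_near1 /within /= => /nbhs_ballP [d /= d0 hd].
exists d => // v hv uv; apply: hd => //.
by rewrite /= in_itv /= andbT; lra.
Qed.

Definition graph_dim (R : realType) : R := 1 + ln 2 / (2 * ln 3).

Lemma graph_dim_gt1 (R : realType) : 1 < graph_dim R.
Proof.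
rewrite /graph_dim ltrDl; apply: divr_gt0; first by apply: ln_gt0; lra.
by apply: mulr_gt0 => //; apply: ln_gt0; lra.
Qed.

(** The critical base: it makes both series of the proof, with ratios 6 * q / 3^s and
3^gamma * q / 3, critical at the same exponent. *)
Lemma powR_graph_dim (R : realType) : 3 `^ graph_dim R * Num.sqrt (1 / 2) = 3.
Proof.
have l3 : 0 < ln 3 :> R by apply: ln_gt0; lra.
set q := Num.sqrt (1 / 2 : R).
have qq : q ^+ 2 = 1 / 2 by rewrite sqr_sqrtr //; lra.
have q0 : 0 <= q by exact: sqrtr_ge0.
rewrite /graph_dim powRD ?pnatr_eq0 ?implybT // powRr1 // -mulrA.
rewrite -[RHS]mulr1; congr (_ * _).
rewrite /powR pnatr_eq0 /=.
have -> : ln 2 / (2 * ln 3) * ln 3 = ln 2 / 2 :> R by field; rewrite gt_eqF.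
set y := expR _.
have yy : y ^+ 2 = 2.
  by rewrite /y -expRM_natl mulrCA divff ?mulr1 ?lnK ?posrE ?pnatr_eq0.
have y0 : 0 <= y by exact: expR_ge0.
apply/eqP; rewrite -(@eqrXn2 _ 2%N) ?mulr_ge0 ?ler01 //.
by rewrite exprMn yy qq expr1n; apply/eqP; lra.
Qed.

Theorem theorem1p6 (R : realType) (d : measure_display) (T : measurableType d)
    (P : probability T R) (B : R -> {RV P >-> R}) (hB : brownian_motion P B) :
  let X : R -> {RV P >-> R} := fun t => B (cantor_function t) in
  {ae P, forall w : T,
    let G := graph (fun t => X t w) `[0, 1] in
    hausdorff_dim G = (1 + ln 2 / (2 * ln 3))%:E /\ fourier_dim G = 0%E}.
Proof.
move=> X.
have [tp tpP] : exists tp : nat -> nat -> R, forall N j, (j < 2 ^ N)%N ->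
    0 <= tp N j <= 1 /\ cantor_function (tp N j) = j%:R / 2 ^+ N.
  have /choice [t ht] : forall Nj : nat * nat, exists t : R, (Nj.2 < 2 ^ Nj.1)%N ->
      0 <= t <= 1 /\ cantor_function t = Nj.2%:R / 2 ^+ Nj.1.
    move=> [N j] /=; have [jN|jN] := ltnP j (2 ^ N); last by exists 0.
    by have [t t01 tV] := cantor_surj_dyadic R N j (ltnW jN); exists t.
  by exists (fun N j => t (N, j)) => N j jN; exact: ht.
pose q : R := Num.sqrt (1 / 2).
have q0 : 0 < q by rewrite sqrtr_gt0; lra.
have qq : q ^+ 2 = 1 / 2 by rewrite sqr_sqrtr //; lra.
have dq : 3 `^ graph_dim R * q = 3 := powR_graph_dim R.
have d1 := graph_dim_gt1 R.
pose gam (i : nat) : R := graph_dim R - i.+1%:R^-1.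
have gam0 i : 0 < gam i.
  rewrite /gam subr_gt0; apply: le_lt_trans d1.
  by rewrite invf_le1 ?ler1n ?ltr0n.
have mono3 x y : x < y -> 3 `^ x < 3 `^ y :> R.
  move=> xy; rewrite /powR pnatr_eq0 /= ltr_expR ltr_pM2r //.
  by apply: ln_gt0; lra.
have hen : {ae P, forall w, forall i, exists M : R, 0 <= M /\
    forall N0, exists2 N, (N0 <= N)%N & graph_energy P B tp (3 `^ gam i) N w <= M}.
  apply: ae_foralln => i; apply: ae_energy_bounded_often => //.
  - by move=> N j /tpP [].
  - by move=> N j /tpP [].
  - have : 3 `^ gam i < 3 `^ graph_dim R :> R.
      by apply: mono3; rewrite /gam gtrBl invr_gt0 ltr0n.
    rewrite -(ltr_pM2r q0) dq ltr_pdivrMr // [1 * 3]mul1r; exact: id.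
have [_ _ _ hc] := hB.
have hs := ae_eventually_small_increments P B hB.
move: hen hc hs; apply: filterS3 => w en cont [n0 small].
set G := graph _ _.
split; last exact: fourier_dim_graph_cantor (fun u => B u w).
have gc := within_continuous_eps R (fun u => B u w) cont.
rewrite -/(graph_dim R); apply/eqP; rewrite eq_le; apply/andP; split.
  apply/lee_addgt0Pr => e e0; rewrite -EFinD.
  apply: ereal_inf_lbound; exists (graph_dim R + e) => //; split; first by lra.
  apply: (graph_hausdorff_measure0 R (fun u => B u w) q 132 _ n0) => //; try lra.
    exact: (dyadic_chaining R (fun u => B u w) q n0).
  have : 3 `^ graph_dim R < 3 `^ (graph_dim R + e) by apply: mono3; lra.
  have : 6 * q = 3 `^ graph_dim R.
    have : 3 `^ graph_dim R * q * q = 3 * q by rewrite dq.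
    by rewrite -mulrA -expr2 qq; lra.
  lra.
apply: le_ereal_inf_tmp => _ [s [s0 sH] <-]; rewrite lee_fin leNgt.
apply/negP => sd.
pose i := Num.truncn (graph_dim R - s)^-1.
have hi : i.+1%:R^-1 <= graph_dim R - s.
  rewrite -[leRHS]invrK lef_pV2 ?posrE ?invr_gt0 ?ltr0n ?subr_gt0 //.
  exact/ltW/truncnS_gt.
have sg : 0 <= s <= gam i by rewrite s0 /gam lerBrDr addrC -lerBrDr.
have [M [M0 hM]] := en i.
have /eqP := graph_hausdorff_measure_neq0 R (fun u => B u w) tp (gam i) s M gc
  (fun N j jN => (tpP N j jN).1) (gam0 i) sg M0 hM.
by apply.
Qed.
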